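(* Let $p\in(1,2)$. For any $l\in(0,\pi)$ there exists an initial datum $h_0\in C^2([0,1])$ satisfying $h_0(0)=0$, $h_0(r)\in(0,\pi)$ for all $r\in(0,1]$, $h_0'(0)>0$, $h_{0rr}(0)=0$, $F(h_0)|_{r=1}=0$, $r\mapsto h_0(r)/r\in C^2([0,1])$, and $h_0(1)=l$, such that the maximal existence time $T$ of the classical solution $h$ to the Dirichlet problem $$h_t=F(h)\ \text{ in }(0,T)\times(0,1),\qquad h(0,r)=h_0(r),\ r\in(0,1),\qquad h(t,1)=h_0(1),\ t\in[0,T)$$ satisfies $T<\infty$.
   Context: For a function $h$ of $r$ (possibly also depending on $t$) put $$J(h)=h_r^2+\frac{\sin^2h}{r^2},$$ $$A(h)=(p-1)h_r^2h_{rr}+(p-3)\Big(\frac{h_r^2\sin h\cos h}{r^2}-\frac{h_r\sin^2h}{r^3}\Big)+\frac{h_r^3}{r}+\frac{h_{rr}\sin^2h}{r^2}-\frac{\sin^3h\cos h}{r^4},$$ and $F(h)=J(h)^{(p-4)/2}A(h)$. $C^{1,2}$ means once continuously differentiable in $t$ and twice in $r$. A classical solution in $(0,T)$ with initial datum $h_0$ is a function $h\in C^{1,2}([0,T]\times[0,1])$ satisfying the Dirichlet problem pointwise in $[0,T]\times[0,1]$ (at $r=0$ the right-hand side $F(h)$ is understood as its limit as $r\to0^+$). The maximal existence time $T\in(0,\infty]$ is the supremum of the times up to which the classical solution exists (for $h_0$ as in the claim, the classical solution exists for short time and is unique). *)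

(* Defs.v *)
From Stdlib Require Import Reals.
From Coquelicot Require Import Coquelicot.

Open Scope R_scope.

(* J, A and F are written as functions of the radius r and of the values
   u = h(r), u1 = h_r(r), u2 = h_rr(r). *)

Definition J (r u u1 : R) : R := u1 ^ 2 + (sin u) ^ 2 / r ^ 2.

Definition A (p r u u1 u2 : R) : R :=
  (p - 1) * u1 ^ 2 * u2
  + (p - 3) * (u1 ^ 2 * sin u * cos u / r ^ 2 - u1 * (sin u) ^ 2 / r ^ 3)
  + u1 ^ 3 / r
  + u2 * (sin u) ^ 2 / r ^ 2
  - (sin u) ^ 3 * cos u / r ^ 4.

Definition F (p r u u1 u2 : R) : R :=
  Rpower (J r u u1) ((p - 4) / 2) * A p r u u1 u2.

(* Derivative at x relative to [a, b], hence one-sided at the endpoints;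
   unique when a < b and x lies in [a, b]. *)
Definition is_derive_in (a b : R) (f : R -> R) (x l : R) : Prop :=
  filterlim (fun y => (f y - f x) / (y - x))
    (within (fun y => a <= y <= b) (locally' x)) (locally l).

(* f is C^2 on [0, 1] with first and second derivatives f1 and f2. *)
Definition is_C2 (f f1 f2 : R -> R) : Prop :=
  (forall x, 0 <= x <= 1 ->
     is_derive_in 0 1 f x (f1 x) /\ is_derive_in 0 1 f1 x (f2 x)) /\
  continuous_on (fun x => 0 <= x <= 1) f2.

Definition rect (T : R) (z : R * R) : Prop :=
  0 <= fst z <= T /\ 0 <= snd z <= 1.

Definition continuous_on_rect (T : R) (f : R -> R -> R) : Prop :=
  continuous_on (rect T) (fun z : R * R => f (fst z) (snd z)).

(* h (arguments t, r) is C^{1,2} on [0, T] x [0, 1], with derivatives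
   h_t = ht, h_r = hr and h_rr = hrr. *)
Definition is_C12 (T : R) (h ht hr hrr : R -> R -> R) : Prop :=
  (forall t r, 0 <= t <= T -> 0 <= r <= 1 ->
     is_derive_in 0 T (fun s => h s r) t (ht t r) /\
     is_derive_in 0 1 (h t) r (hr t r) /\
     is_derive_in 0 1 (hr t) r (hrr t r)) /\
  continuous_on_rect T h /\ continuous_on_rect T ht /\
  continuous_on_rect T hr /\ continuous_on_rect T hrr.

(* The condition 0 < J says that F(h) is defined: its exponent (p - 4) / 2 is
   negative, whereas Rpower is total. At r = 0 the right-hand side is the limit
   as r -> 0+. *)
Definition classical_solution (p : R) (h0 : R -> R) (T : R)
    (h : R -> R -> R) : Prop :=
  exists ht hr hrr : R -> R -> R,
    is_C12 T h ht hr hrr /\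
    (forall t r, 0 <= t <= T -> 0 < r <= 1 ->
       0 < J r (h t r) (hr t r) /\
       ht t r = F p r (h t r) (hr t r) (hrr t r)) /\
    (forall t, 0 <= t <= T ->
       filterlim (fun r => F p r (h t r) (hr t r) (hrr t r))
         (at_right 0) (locally (ht t 0))) /\
    (forall r, 0 <= r <= 1 -> h 0 r = h0 r) /\
    (forall t, 0 <= t <= T -> h t 1 = h0 1).

Definition maximal_existence_time (p : R) (h0 : R -> R) : Rbar :=
  Lub_Rbar (fun T => 0 < T /\ exists h, classical_solution p h0 T h).

(* The last clause is h0(r)/r in C^2([0, 1]): the quotient, extended to r = 0 by
   its limit, is g. *)
Definition admissible (p l : R) (h0 : R -> R) : Prop :=
  (exists h1 h2 : R -> R,
     is_C2 h0 h1 h2 /\ 0 < h1 0 /\ h2 0 = 0 /\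
     F p 1 (h0 1) (h1 1) (h2 1) = 0) /\
  h0 0 = 0 /\
  (forall r, 0 < r <= 1 -> 0 < h0 r < PI) /\
  h0 1 = l /\
  (exists g g1 g2 : R -> R,
     is_C2 g g1 g2 /\ forall r, 0 < r <= 1 -> g r = h0 r / r).

(* Main.v *)
Require Import Defs.
From Stdlib Require Import Reals Lra Psatz Classical ClassicalEpsilon.
From Coquelicot Require Import Coquelicot.

Open Scope R_scope.

(* F scales like r^(-p), so that f(t,r) = 2 atan (tau (r / lam(t))) with
   lam' = - c lam^(1-p), which concentrates at the origin in finite time, is a
   strict subsolution as soon as a pointwise inequality holds for the profile
   tau. For tau(rho) = M (rho - d) / (1 + rho)^2 it does: while tau increases,
   f is close to the harmonic bubble 2 atan (M rho), which is a strict static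
   subsolution for p < 2; where tau decreases, f stays above PI/2 for so long
   (M is large) that c rho^p becomes large, and then the negative f_t dominates.
   A solution starting above f stays above f: at a first contact point the
   derivatives compare, and no contact occurs at r = 0, where f < 0 = h, nor at
   r = 1, where f is smaller than l. Since f(t, lam(t)) > PI/2, the solution
   cannot remain continuous at r = 0 up to the time when lam vanishes. *)

(** For the pure bubble [tau = M rho], [excess] equals [2 q tau^3 / (1 + tau^2)]: positive, but only
    of third order at the origin. Bending the bubble into [M rho / (1 + rho)^2] makes [excess]
    behave like [-(6 - 3 q) M rho^2] there, which is negative. So the shift [d] does more than
    exclude contact at the origin: it opens a gap of about [eta = M d] between the profile and its
    logarithmic derivatives, and this gap restores a strict margin near 0. It has to be small
    against [q], and [M] so large that errors of order [1/M] are small against [eta]. The Dirichlet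
    problem prescribes no value at [r = 0] for positive times; that [h] vanishes there has to be
    extracted from the finiteness of the limit of [F]. The constants are chosen without circularity:
    [c], [M], [d] depend on [p] alone; then the initial scale is made small in terms of [l]; last,
    the datum is raised above the barrier by a parameter that does not affect its value and first
    two derivatives at [r = 1]. *)

(* With [tau, y, z] the values of a profile and of its first two logarithmic
   derivatives, and [u = 2 atan tau], this is [r^4 A] divided by the positive
   factor [8 (y^2 + tau^2) / (1 + tau^2)^3]; here [q = 2 - p]. *)
Definition excess (q tau y z : R) : R :=
  z - tau + q * y - q * (y^2/(y^2+tau^2)) * (z+tau)
  - (2*tau/(1+tau^2)) * ((1-q)*y^2 - tau^2).

(** * The profile inequality *)

Lemma one_plus_sq (x : R) : 0 < 1 + x^2.
Proof. pose proof (pow2_ge_0 x). lra. Qed.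

Lemma ratio01 (y t : R) : 0 < y^2+t^2 -> 0 <= y^2/(y^2+t^2) <= 1.
Proof.
intros H. split.
- apply Rmult_le_pos. nra. left; now apply Rinv_0_lt_compat.
- apply (Rmult_le_reg_r (y^2+t^2)); trivial. field_simplify; nra.
Qed.

(** Serves [rho <= d]. All terms other than [q*y] add up to something nonnegative: the only harmful
    one, [s*t^2] with [s = 2*t/(1+t^2)], is outweighed by [-t] because [t] is small. *)
Lemma excess_of_nonpos (q t y z g : R) : 0 < q < 1 -> -1/4 <= t <= 0 -> 0 < y -> 0 <= z -> g < q ->
  g * y < excess q t y z.
Proof.
intros Hq Ht Hy Hz Hg. unfold excess.
assert (HS : 0 < y^2+t^2) by nra.
pose proof (ratio01 y t HS) as Ho. set (o := y^2/(y^2+t^2)) in *. clearbody o.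
assert (HW : 0 < 1 + t^2) by nra.
set (s := 2*t/(1+t^2)).
assert (Hs : s * (1+t^2) = 2*t) by (unfold s; field; lra).
assert (Hs1 : 2*t <= s <= 0) by (clearbody s; split; nra). clearbody s.
assert (0 <= q*o <= 1) by nra.
set (qo := q * o) in *. clearbody qo.
assert (0 <= z*(1-qo)) by nra.
assert (0 <= (-t) * qo) by nra.
assert (0 <= - s * ((1-q)*y^2)) by (apply Rmult_le_pos; nra).
assert (s * t^2 >= 2*t*t^2) by nra.
assert (2*t*t^2 >= t) by nra.
nra.
Qed.

(** Removes the quotient [o = y^2/(y^2+t^2)]: since [z <= y], the terms with factor [q] outside the
    last one are at least [y - o*(y+t)], which is [-(y-t)/2] plus the nonnegative
    [(y-t)^3/(2*(y^2+t^2))]. *)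
Lemma excess_lower (q t y z : R) : 0 < q < 1 -> 0 < t -> 0 < y -> z <= y -> t <= y ->
  z - t - q*(y-t)/2 + (2*t/(1+t^2)) * (q*y^2 - (y-t)*(y+t)) <= excess q t y z.
Proof.
intros Hq Ht Hy Hz Hty. unfold excess.
assert (HS : 0 < y^2+t^2) by nra.
pose proof (ratio01 y t HS) as Ho.
assert (E : y - y^2/(y^2+t^2)*(y+t) + (y-t)/2 = (y-t)*(y-t)^2/(2*(y^2+t^2))).
{ field. lra. }
assert (0 <= (y-t)*(y-t)^2/(2*(y^2+t^2))).
{ apply Rmult_le_pos; [apply Rmult_le_pos; [lra | apply pow2_ge_0] | left; apply Rinv_0_lt_compat; lra]. }
set (o := y^2/(y^2+t^2)) in *. clearbody o.
assert (o*(z+t) <= o*(y+t)) by nra.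
assert (0 <= q*(y - o*(z+t) + (y-t)/2)) by (apply Rmult_le_pos; lra).
set (s := 2*t/(1+t^2)) in *. clearbody s.
nra.
Qed.

(** Here [w] stands for [M rho], and [e] bounds the error of the linearised profile. The gain is
    [z - t], about [eta]. The last term of [excess_lower] costs at most [(y-t)/5] while [t <= 1/5];
    beyond that, [eta <= q/20] gives [y - t <= q*y/2], and [q*y^2] absorbs the cost. *)
Lemma excess_inner (q eta e w t y z : R) : 0 < q < 1 -> 0 < eta <= q/20 -> 0 <= e <= eta/100 ->
  0 < t -> 0 < y -> z <= y -> w-e <= z -> w-e <= y <= w+e -> w-eta-e <= t <= w-eta+e ->
  eta/4 <= excess q t y z.
Proof.
intros Hq Heta He Ht Hy Hzy Hz Hyw Htw.
assert (Hty : t <= y) by lra.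
eapply Rle_trans; [| now apply excess_lower].
set (s := 2*t/(1+t^2)).
assert (Hs : s * (1+t^2) = 2*t) by (unfold s; field; nra).
assert (Hs1 : 0 < s <= 2*t) by (clearbody s; split; nra). clearbody s.
assert (q*(y-t) <= y-t) by nra.
destruct (Rle_dec t (1/5)).
- assert (s*(y-t)*(y+t) <= 2/5 * (y-t)*(y+t)) by (repeat apply Rmult_le_compat_r; lra).
  assert (2/5 * (y-t)*(y+t) <= 2/5*(y-t)*(1/2)) by (apply Rmult_le_compat_l; nra).
  assert (0 <= s * (q*y^2)) by (apply Rmult_le_pos; nra). nra.
- assert (0 <= q*y^2 - (y-t)*(y+t)).
  { assert (y-t <= q*y/2) by nra.
    assert ((y-t)*(y+t) <= (q*y/2)*(2*y)) by (apply Rmult_le_compat; lra). nra. }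
  assert (0 <= s * (q*y^2 - (y-t)*(y+t))) by (apply Rmult_le_pos; lra). lra.
Qed.

Lemma omega_lip (k a : R) : 0 <= a -> (k+a)^2/(1+(k+a)^2) - k^2/(1+k^2) <= a.
Proof.
intros Ha.
assert (E : (k+a)^2/(1+(k+a)^2) - k^2/(1+k^2) = a*(2*k+a)/((1+(k+a)^2)*(1+k^2))).
{ field. pose proof (pow2_ge_0 (k+a)). pose proof (pow2_ge_0 k). split; lra. }
rewrite E. assert (HP : 0 < (1+(k+a)^2)*(1+k^2)) by (apply Rmult_lt_0_compat; apply one_plus_sq).
clear E; apply (Rmult_le_reg_r ((1+(k+a)^2)*(1+k^2))); trivial.
unfold Rdiv; rewrite Rmult_assoc, Rinv_l, Rmult_1_r by nra.
apply Rmult_le_compat_l; trivial.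
assert (2*k+a <= (1+(k+a)^2)*(1+k^2)).
{ assert ((k+a)+k <= (1+(k+a)^2)*(1+k^2)). 2: lra.
  set (b := k+a). pose proof (pow2_ge_0 (b-1/2)). pose proof (pow2_ge_0 (k-1/2)). pose proof (pow2_ge_0 (b*k)). nra. }
lra.
Qed.

(** Coordinates suited to large [t]: with [k = y/t] and [Z = 1 + z/t], the bracket depends on [t]
    only through its last term, which decays like [1/t^2]. *)
Lemma excess_ratio (q t k Z : R) : 0 < t ->
  excess q t (k*t) ((Z-1)*t) =
  t * ((1 - q*(k^2/(1+k^2)))*Z + q*k - 2*(1-q)*k^2 + 2/(1+t^2)*((1-q)*k^2-1)).
Proof. intros Ht. unfold excess. field. repeat split; nra. Qed.

(* The value of [excess / tau] for [d = 0] and [tau] infinite. *)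
Definition limit_excess (q rho : R) := (rho*(1+rho^2)*(2-q)+2*q)/((1+rho)^2*(1+rho^2)).

Lemma limit_excess_eq (q rho : R) : 0 < rho -> let k := (1-rho)/(1+rho) in
  (1 - q*(k^2/(1+k^2)))*(2*(1-rho+rho^2)/(1+rho)^2) + q*k - 2*(1-q)*k^2 = limit_excess q rho.
Proof. intros H k. unfold k, limit_excess. field. repeat split; nra. Qed.

(** The shift [d] turns the ratio [k] into [k + a] with [a = d/(rho - d)]. The changes of the
    quotient, of the factor it multiplies and of the quadratic term cost at most [2*a], [3*a] and
    [6*a]. *)
Lemma limit_excess_perturbed (q rho a : R) : 0 < q < 1 -> 0 < rho -> 0 <= a <= 1/10 -> 
  let k := (1-rho)/(1+rho) in
  limit_excess q rho - 12*a <= 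
  (1 - q*((k+a)^2/(1+(k+a)^2)))*(2*(1-rho+rho^2)/(1+rho)^2 + a*(2*k-1)) + q*(k+a) - 2*(1-q)*(k+a)^2.
Proof.
intros Hq Hr Ha k.
rewrite <- (limit_excess_eq q rho Hr). fold k.
pose proof (omega_lip k a (proj1 Ha)) as HL.
assert (Hk : -1 <= k <= 1).
{ assert (k*(1+rho) = 1-rho) by (unfold k; field; lra). split; nra. }
set (Z := 2*(1-rho+rho^2)/(1+rho)^2).
assert (HZ : 0 <= Z <= 2).
{ assert (EZ : Z = (1+3*k^2)/2) by (unfold Z, k; field; lra). rewrite EZ. nra. }
clearbody k Z.
assert (Ho : 0 <= (k+a)^2/(1+(k+a)^2) <= 1).
{ pose proof (ratio01 (k+a) 1) as HH. replace ((k+a)^2+1^2) with (1+(k+a)^2) in HH by ring. apply HH, one_plus_sq. }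
set (o1 := (k+a)^2/(1+(k+a)^2)) in *. set (o := k^2/(1+k^2)) in *. clearbody o o1.
assert (q*(o1-o)*Z <= 2*a).
{ assert (q*(o1-o) <= a) by (destruct (Rle_dec 0 (o1-o)); nra). nra. }
assert ((1-q*o1)*(a*(2*k-1)) >= -3*a).
{ assert (0 <= 1-q*o1 <= 1) by nra. assert (-(3*a) <= a*(2*k-1)) by nra.
  set (X := 1-q*o1) in *. clearbody X. set (Y := a*(2*k-1)) in *. clearbody Y. nra. }
assert ((1-q)*((k+a)^2-k^2) <= 3*a).
{ assert ((k+a)^2-k^2 <= 3*a) by nra. set (X := (k+a)^2-k^2) in *. clearbody X.
  destruct (Rle_dec 0 X); nra. }
nra.
Qed.

Lemma limit_excess_ge_small (q rho : R) : 0 < q < 1 -> 0 < rho <= 1 -> (2*q+rho)/8 <= limit_excess q rho.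
Proof.
intros Hq Hr. unfold limit_excess.
assert (0 < (1+rho)^2*(1+rho^2) <= 8).
{ split. apply Rmult_lt_0_compat; nra. assert ((1+rho)^2 <= 4) by nra. assert (1+rho^2 <= 2) by nra. nra. }
apply (Rmult_le_reg_r ((1+rho)^2*(1+rho^2))). lra.
unfold Rdiv at 2. rewrite Rmult_assoc, Rinv_l, Rmult_1_r by lra.
apply Rle_trans with ((2*q+rho)/8*8). apply Rmult_le_compat_l; lra.
nra.
Qed.

Lemma limit_excess_ge_large (q rho : R) : 0 < q < 1 -> 1 <= rho -> 1/(4*rho) <= limit_excess q rho.
Proof.
intros Hq Hr. unfold limit_excess.
apply (Rmult_le_reg_r (4*rho*((1+rho)^2*(1+rho^2)))).
{ repeat apply Rmult_lt_0_compat; nra. }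
field_simplify; [| nra | nra].
assert (0 <= rho^3) by (apply pow_le; lra).
assert (0 <= (rho^2-1)*(rho^2)) by nra.
nra.
Qed.


(* [profile1] and [profile2] are the first and second derivatives of [profile]
   with respect to [log rho]. The shift by [d] makes the profile negative at
   [rho = 0], so that the barrier cannot touch the solution at the origin. *)
Definition profile (M d rho : R) := M*(rho-d)/(1+rho)^2.
Definition profile1 (M d rho : R) := M*rho*(1+2*d-rho)/(1+rho)^3.
Definition profile2 (M d rho : R) := M*rho*(1+2*d-4*rho*(1+d)+rho^2)/(1+rho)^4.

(** * Bounds on the profile and on its excess in the successive ranges of [rho] *)

Lemma inv_le_1 (x : R) : 1 <= x -> 0 < /x <= 1.
Proof.
intros H. assert (H0 : 0 < /x) by (apply Rinv_0_lt_compat; lra).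
assert (/x*x = 1) by (field; lra). nra.
Qed.

Lemma inv_pow_bounds (n : nat) (r : R) : 0 <= r -> 1 - INR n * r <= / (1+r)^n <= 1.
Proof.
intros Hr.
assert (H1 : 1 <= (1+r)^n) by (apply pow_R1_Rle; lra).
split.
- induction n as [|n IH]. simpl. rewrite Rinv_1; lra.
  assert (H2 : 1 <= (1+r)^n) by (apply pow_R1_Rle; lra).
  specialize (IH H2). rewrite S_INR. simpl. rewrite Rinv_mult.
  assert (/(1+r)*(1+r) = 1) by (field; lra).
  assert (1 - r <= /(1+r) <= 1) by nra.
  assert (0 < /(1+r)^n <= 1).
  { now apply inv_le_1. }
  assert ((1-/(1+r)) * /(1+r)^n <= r) by nra.
  nra.
- now apply inv_le_1.
Qed.

Lemma profile_inner_bounds (M eta d rho w e : R) :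
  w = M*rho -> eta = M*d -> 0 < d < rho -> rho <= 1/10 -> 0 < M -> 9*rho*w <= e -> 2*d*w <= e ->
  let t := profile M d rho in let y := profile1 M d rho in let z := profile2 M d rho in
  0 < t /\ 0 < y /\ z <= y /\ w-e <= z /\ w-e <= y <= w+e /\ w-eta-e <= t <= w-eta+e.
Proof.
intros Hw Heta Hd Hr HM He1 He2 t y z.
assert (Hw0 : 0 < w) by nra.
assert (Hwe : 0 < w - eta) by nra.
pose proof (inv_pow_bounds 2 rho ltac:(lra)) as B2.
pose proof (inv_pow_bounds 3 rho ltac:(lra)) as B3.
pose proof (inv_pow_bounds 4 rho ltac:(lra)) as B4.
simpl INR in B2, B3, B4.
assert (Et : t = (w-eta) * /(1+rho)^2) by (unfold t, profile; subst; field; lra).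
assert (Ey : y = w*(1+2*d-rho) * /(1+rho)^3) by (unfold y, profile1; subst; field; lra).
assert (Ez : z = w*(1+2*d-4*rho*(1+d)+rho^2) * /(1+rho)^4) by (unfold z, profile2; subst; field; lra).
assert (Ezy : z = w*(1+2*d-4*rho*(1+d)+rho^2) * /(1+rho) * /(1+rho)^3) by (unfold z, profile2; subst; field; lra).
assert (P1 : 0 < /(1+rho)^2 ) by (apply Rinv_0_lt_compat, pow_lt; lra).
assert (P3 : 0 < /(1+rho)^3 ) by (apply Rinv_0_lt_compat, pow_lt; lra).
assert (Q1 : /(1+rho)*(1+rho) = 1) by (field; lra).
set (i1 := /(1+rho)) in *. set (i2 := /(1+rho)^2) in *. set (i3 := /(1+rho)^3) in *. set (i4 := /(1+rho)^4) in *.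
clearbody t y z i1 i2 i3 i4.
repeat split.
- rewrite Et. nra.
- rewrite Ey. repeat apply Rmult_lt_0_compat; lra.
- rewrite Ezy, Ey. apply Rmult_le_compat_r; [lra|]. rewrite Rmult_assoc. apply Rmult_le_compat_l; [lra|].
  apply (Rmult_le_reg_r (1+rho)); [lra|]. rewrite Rmult_assoc, Q1. nra.
- rewrite Ez. rewrite Rmult_assoc.
  assert (1-9*rho <= (1+2*d-4*rho*(1+d)+rho^2)*i4).
  { assert (1-5*rho <= 1+2*d-4*rho*(1+d)+rho^2) by nra.
    assert ((1-5*rho)*(1-4*rho) <= (1+2*d-4*rho*(1+d)+rho^2)*i4) by (apply Rmult_le_compat; lra). nra. }
  nra.
- rewrite Ey, Rmult_assoc.
  assert ((1-rho)*(1-3*rho) <= (1+2*d-rho)*i3) by (apply Rmult_le_compat; lra).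
  nra.
- rewrite Ey, Rmult_assoc.
  assert ((1+2*d-rho)*i3 <= (1+2*d)*1) by (apply Rmult_le_compat; lra). nra.
- rewrite Et. assert ((w-eta)*(1-2*rho) <= (w-eta)*i2) by (apply Rmult_le_compat_l; lra). nra.
- rewrite Et. nra.
Qed.

Lemma profile_ratios (M d rho : R) : 0 < d < rho -> 
  let a := d/(rho-d) in let k := (1-rho)/(1+rho) in let t := profile M d rho in
  profile1 M d rho = (k+a)*t /\
  profile2 M d rho = (2*(1-rho+rho^2)/(1+rho)^2 + a*(2*k-1) - 1)*t.
Proof.
intros H a k t. unfold a, k, t, profile, profile1, profile2. split; field; lra.
Qed.

Lemma excess_mid_small (q eta M d rho : R) : 0 < q < 1 -> 0 < eta <= q/20 -> eta = M*d -> 0 < d ->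
  0 < M -> 40/M <= rho <= 1 ->
  0 < profile M d rho /\ 0 <= profile1 M d rho <= 2 * profile M d rho /\
  q/8*profile M d rho <= excess q (profile M d rho) (profile1 M d rho) (profile2 M d rho).
Proof.
intros Hq He Hed Hd HM Hr.
assert (HMr : 40 <= M*rho). { apply Rmult_le_reg_r with (/M). now apply Rinv_0_lt_compat. replace (M*rho*/M) with rho by (field; lra). unfold Rdiv in Hr; lra. }
assert (Hdr : d < rho) by nra.
destruct (profile_ratios M d rho (conj Hd Hdr)) as [Ey Ez].
set (a := d/(rho-d)) in *. set (k := (1-rho)/(1+rho)) in *.
assert (Ha : 0 <= a <= eta/39).
{ assert (Ea : a * (M*(rho-d)) = eta) by (unfold a; subst eta; field; lra).
  assert (39 <= M*(rho-d)) by nra. 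
  assert (0 <= a) by (unfold a; apply Rmult_le_pos; [lra | left; apply Rinv_0_lt_compat; lra]).
  split; trivial. nra. }
assert (Hk : 0 <= k <= 1).
{ assert (k*(1+rho) = 1-rho) by (unfold k; field; lra). split; nra. }
set (t := profile M d rho) in *.
assert (Ht : 9 <= t).
{ unfold t, profile. apply (Rmult_le_reg_r ((1+rho)^2)). nra. unfold Rdiv. rewrite Rmult_assoc, Rinv_l, Rmult_1_r by nra.
  assert ((1+rho)^2 <= 4) by nra. nra. }
split; [lra|]. split. { rewrite Ey. split; nra. }
rewrite Ey, Ez, excess_ratio by lra.
rewrite Rmult_comm. apply Rmult_le_compat_l; [lra|].
pose proof (limit_excess_perturbed q rho a Hq ltac:(nra) ltac:(nra)) as HN. fold k in HN. cbv zeta in HN.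
pose proof (limit_excess_ge_small q rho Hq ltac:(nra)) as H0.
assert (HW : 0 < 2/(1+t^2) <= 1/40).
{ split. apply Rdiv_lt_0_compat; nra. apply (Rmult_le_reg_r (1+t^2)). nra. field_simplify; nra. }
(* The trivial bound by [-1] would not do: the available margin [(2*q+rho)/8] is itself small when
   [q] and [rho] are, so the correction must be small in the same way. *)
assert (HK : -(q+4*rho) <= (1-q)*(k+a)^2-1).
{ assert (1 - 4*rho <= k^2).
  { assert (1-2*rho <= k). { assert (k*(1+rho) = 1-rho) by (unfold k; field; lra). nra. }
    destruct (Rle_dec (2*rho) 1); nra. }
  assert (k^2 <= (k+a)^2) by nra.
  assert ((1-q)*(1-4*rho) <= (1-q)*(k+a)^2) by (apply Rmult_le_compat_l; lra). nra. }
assert (2/(1+t^2) * (-(q+4*rho)) <= 2/(1+t^2)*((1-q)*(k+a)^2-1)) by (apply Rmult_le_compat_l; lra).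
assert (1/40 * (-(q+4*rho)) <= 2/(1+t^2) * (-(q+4*rho))) by nra.
fold k. lra.
Qed.

(** The margin [limit_excess] decays like [1/rho], while the correction [2/(1+t^2)] grows like
    [rho^2/M^2]. The margin wins as long as [rho^3] is small against [M^2 = N^4], in particular up
    to [rho = N]; this is why the last split is at the square root of [M]. *)
Lemma excess_mid_large (q eta M N d rho : R) : 0 < q < 1 -> 0 < eta <= q/20 -> eta = M*d -> 0 < d ->
  M = N^2 -> 5000 <= N -> 1 <= rho <= N ->
  0 < profile M d rho /\ profile1 M d rho <= profile M d rho /\
  1/(8*rho) * profile M d rho <= excess q (profile M d rho) (profile1 M d rho) (profile2 M d rho).
Proof.
intros Hq He Hed Hd HMN HN Hr.
assert (HM : 25000000 <= M) by nra.
assert (Hd1 : d <= 1/1000000) by nra.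
assert (Hdr : d < rho) by lra.
destruct (profile_ratios M d rho (conj Hd Hdr)) as [Ey Ez].
set (a := d/(rho-d)) in *. set (k := (1-rho)/(1+rho)) in *.
assert (Ha : 0 <= a).
{ unfold a; apply Rmult_le_pos; [lra | left; apply Rinv_0_lt_compat; lra]. }
assert (Ha2 : a*rho <= 1/100000).
{ assert (Ea : a * (rho-d) = d) by (unfold a; field; lra). nra. }
assert (Ha1 : a <= 1/100000) by nra.
assert (Hk : -1 <= k <= 0).
{ assert (k*(1+rho) = 1-rho) by (unfold k; field; lra). split; nra. }
set (t := profile M d rho) in *.
assert (Ht : M <= 8*rho*t).
{ unfold t, profile. apply (Rmult_le_reg_r ((1+rho)^2)). nra. unfold Rdiv. 
  replace (8 * rho * (M * (rho - d) * / (1 + rho) ^ 2) * (1 + rho) ^ 2) with (8*rho*(M*(rho-d))) by (field; lra).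
  assert ((1+rho)^2 <= 4*rho^2) by nra.
  assert (M*(1+rho)^2 <= M*(4*rho^2)) by (apply Rmult_le_compat_l; lra).
  assert (M*(4*rho^2) <= M*(8*rho*(rho-d))) by (apply Rmult_le_compat_l; nra). lra. }
assert (Htp : 0 < t) by nra.
split; [lra|]. split. { rewrite Ey. nra. }
rewrite Ey, Ez, excess_ratio by lra.
rewrite Rmult_comm. apply Rmult_le_compat_l; [lra|].
pose proof (limit_excess_perturbed q rho a Hq ltac:(nra) ltac:(nra)) as Hn. fold k in Hn. cbv zeta in Hn.
pose proof (limit_excess_ge_large q rho Hq ltac:(lra)) as H0.
assert (HW : 0 < 2/(1+t^2) <= 1/(16*rho)).
{ split. apply Rdiv_lt_0_compat; nra. apply (Rmult_le_reg_r (16*rho*(1+t^2))). nra. field_simplify; [|nra|nra].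
  assert (32*rho <= t^2).
  { apply (Rmult_le_reg_r (64*rho^2)). nra.
    assert (M^2 <= (8*rho*t)^2) by (apply pow_incr; lra).
    assert (2048*rho^3 <= M^2).
    { assert (rho^3 <= N^3) by (apply pow_incr; lra). rewrite HMN.
      assert (0 <= N^3*(N-2048)). { apply Rmult_le_pos. apply pow_le; lra. lra. } nra. }
    nra. }
  nra. }
assert (HK : -1 <= (1-q)*(k+a)^2-1).
{ assert (0 <= (1-q)*(k+a)^2) by (apply Rmult_le_pos; [lra|apply pow2_ge_0]). lra. }
assert (2/(1+t^2) * (-1) <= 2/(1+t^2)*((1-q)*(k+a)^2-1)) by (apply Rmult_le_compat_l; lra).
assert (12*a <= 1/(16*rho)).
{ apply (Rmult_le_reg_r (16*rho)). nra. field_simplify; nra. }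
assert (1/(4*rho) = 1/(8*rho) + 1/(16*rho) + 1/(16*rho)) by (field; lra).
fold k. lra.
Qed.

(** Beyond [N] the sign of [excess] is given up. What counts is that [y/t] is close to [-1], so that
    the time term is negative and of the order of [t] times a large factor. *)
Lemma excess_tail (q M N d rho : R) : 0 < q < 1 -> 0 < d <= 1/10 -> M = N^2 -> 5000 <= N -> N <= rho ->
  let t := profile M d rho in let y := profile1 M d rho in
  M/(2*rho) <= t <= M/rho /\ y <= - t/2 /\ -3*t <= excess q t y (profile2 M d rho).
Proof.
intros Hq Hd HMN HN Hr t y.
assert (HM : 0 < M) by nra.
destruct (profile_ratios M d rho ltac:(lra)) as [Ey Ez].
set (a := d/(rho-d)) in *. set (k := (1-rho)/(1+rho)) in *. fold t in Ey, Ez. fold y in Ey.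
assert (Ht : M/(2*rho) <= t <= M/rho).
{ unfold t, profile. split; apply (Rmult_le_reg_r (rho * (1+rho)^2)); try (apply Rmult_lt_0_compat; [lra | apply pow_lt; lra]).
  - replace (M / (2 * rho) * (rho * (1 + rho) ^ 2)) with (M*((1+rho)^2/2)) by (field; lra).
    replace (M * (rho - d) / (1 + rho) ^ 2 * (rho * (1 + rho) ^ 2)) with (M*((rho-d)*rho)) by (field; lra).
    apply Rmult_le_compat_l; nra.
  - replace (M / rho * (rho * (1 + rho) ^ 2)) with (M*((1+rho)^2)) by (field; lra).
    replace (M * (rho - d) / (1 + rho) ^ 2 * (rho * (1 + rho) ^ 2)) with (M*((rho-d)*rho)) by (field; lra).
    apply Rmult_le_compat_l; nra. }
split; trivial.
assert (Htp : 0 < t). { destruct Ht as [Ht _]. eapply Rlt_le_trans; [|exact Ht]. apply Rdiv_lt_0_compat; lra. }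
assert (Ha : 0 <= a <= 1/1000).
{ assert (Ea : a * (rho-d) = d) by (unfold a; field; lra).
  split. unfold a; apply Rmult_le_pos; [lra | left; apply Rinv_0_lt_compat; lra]. nra. }
assert (Hk : -1 <= k <= -99/100).
{ assert (k*(1+rho) = 1-rho) by (unfold k; field; lra). split; nra. }
split. { rewrite Ey. nra. }
rewrite Ey, Ez, excess_ratio by lra.
replace (-3*t) with (t*(-3)) by ring. apply Rmult_le_compat_l; [lra|].
set (Z := 2 * (1 - rho + rho ^ 2) / (1 + rho) ^ 2 + a * (2 * k - 1)).
assert (HZ : 0 <= Z).
{ assert (EZ : 2 * (1 - rho + rho ^ 2) / (1 + rho) ^ 2 = (1+3*k^2)/2) by (unfold k; field; lra). unfold Z. rewrite EZ. nra. }
assert (HO : 0 <= (k+a)^2/(1+(k+a)^2) <= 1).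
{ pose proof (ratio01 (k+a) 1) as HH. replace ((k+a)^2+1^2) with (1+(k+a)^2) in HH by ring. apply HH, one_plus_sq. }
set (o := (k+a)^2/(1+(k+a)^2)) in *. clearbody o Z.
assert (0 <= (1-q*o)*Z) by (apply Rmult_le_pos; nra).
assert (HK2 : 0 <= (k+a)^2 <= 1) by nra.
assert (HW : 0 < 2/(1+t^2) <= 2).
{ split. apply Rdiv_lt_0_compat; nra. apply (Rmult_le_reg_r (1+t^2)). nra. field_simplify; nra. }
assert (-1 <= k + a) by lra.
set (m := (1-q)*(k+a)^2) in *.
assert (0 <= m <= 1-q) by (unfold m; nra).
replace (2*(1-q)*(k+a)^2) with (2*m) by (unfold m; ring). clearbody m.
set (v := 2/(1+t^2)) in *. clearbody v.
assert (v*(m-1) >= 2*(m-1)) by nra.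
nra.
Qed.


(** * Bounds on the real powers in the time term *)

Lemma Rpower_base_1 (x : R) : Rpower 1 x = 1.
Proof. unfold Rpower. now rewrite ln_1, Rmult_0_r, exp_0. Qed.

Lemma Rpower_half_le_5 (X q : R) : 0 < q < 1 -> 0 < X <= 25 -> 0 < Rpower X (q/2) <= 5.
Proof.
intros Hq HX. split. apply exp_pos.
apply Rle_trans with (Rpower 25 (q/2)). apply Rle_Rpower_l; lra.
apply Rle_trans with (Rpower 25 (/2)). apply Rle_Rpower; lra.
rewrite Rpower_sqrt by lra. replace 25 with (5*5) by ring. rewrite sqrt_square; lra.
Qed.

Lemma Rpower_le_id (r p : R) : 1 <= p -> 0 < r <= 1 -> 0 < Rpower r p <= r.
Proof.
intros Hp Hr. split. apply exp_pos.
replace p with (1+(p-1)) by ring. rewrite Rpower_plus, Rpower_1 by lra.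
assert (Rpower r (p-1) <= 1). { pose proof (Rle_Rpower_l r 1 (p-1)) as H. rewrite Rpower_base_1 in H. apply H; lra. }
nra.
Qed.

Lemma Rpower_ge_id (r p : R) : p <= 1 -> 0 < r <= 1 -> r <= Rpower r p.
Proof.
intros Hp Hr.
replace p with (1-(1-p)) by ring. unfold Rminus at 1. rewrite Rpower_plus, Rpower_Ropp, Rpower_1 by lra.
assert (0 < Rpower r (1-p) <= 1).
{ split. apply exp_pos. pose proof (Rle_Rpower_l r 1 (1-p)) as H. rewrite Rpower_base_1 in H. apply H; lra. }
assert (1 <= / Rpower r (1-p)). { pose proof (Rinv_le_contravar (Rpower r (1-p)) 1). lra. }
nra.
Qed.

(* [(r u_r)^2 + sin^2 u], that is [r^2 J], for [u = 2 atan t] and [r t_r = y]. *)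
Definition speed_ratio (t y : R) := 4*(y^2+t^2)/(1+t^2)^2.

Lemma speed_ratio_bound (t y b : R) : 0 < y^2+t^2 -> 4*(y^2+t^2) <= b*(1+t^2)^2 -> 
  0 < speed_ratio t y <= b.
Proof.
intros H1 H2. unfold speed_ratio.
assert (HW : 0 < (1+t^2)^2) by (apply pow_lt, one_plus_sq).
split. apply Rdiv_lt_0_compat; lra.
apply (Rmult_le_reg_r ((1+t^2)^2)); trivial. field_simplify; try lra. pose proof (one_plus_sq t); lra.
Qed.

Lemma speed_ratio_le_5 (q t y : R) : 0 < q < 1 -> 0 < y^2+t^2 -> y^2 <= 4*t^2+4 ->
  0 < Rpower (speed_ratio t y) (q/2) <= 5.
Proof.
intros Hq H1 H2. apply Rpower_half_le_5; trivial. apply speed_ratio_bound; trivial. nra.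
Qed.

(** Dropping [y^2] from [speed_ratio] leaves the square of [2*t/(1+t^2)], and the square turns the
    exponent [q/2] into [q]. *)
Lemma speed_ratio_ge (q t y x : R) : 0 < q < 1 -> 0 < t -> 0 < x -> x*(1+t^2) <= 2*t ->
  Rpower x q <= Rpower (speed_ratio t y) (q/2).
Proof.
intros Hq Ht Hx Hxt.
replace (Rpower x q) with (Rpower (x^2) (q/2)).
2: { rewrite <- (Rpower_pow 2 x Hx), Rpower_mult. f_equal. simpl. lra. }
apply Rle_Rpower_l; [lra|]. split. nra.
unfold speed_ratio. 
assert (HW : 0 < (1+t^2)) by (apply one_plus_sq).
apply (Rmult_le_reg_r ((1+t^2)^2)). now apply pow_lt. field_simplify; [|lra].
assert ((x*(1+t^2))^2 <= (2*t)^2) by (apply pow_incr; nra). nra.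
Qed.

Lemma Rmult3_le_compat (a b g a' b' g' : R) : 0 <= a <= a' -> 0 <= b <= b' -> 0 <= g <= g' ->
  a*b*g <= a'*b'*g'.
Proof.
intros Ha Hb Hg. assert (a*b <= a'*b') by (apply Rmult_le_compat; lra).
assert (0 <= a*b) by (apply Rmult_le_pos; lra). apply Rmult_le_compat; lra.
Qed.

(** Keeps [J] positive along the barrier: the profile vanishes only at [rho = d], where it is
    strictly increasing. *)
Lemma profile_nondegenerate (M d rho : R) : 0 < M -> 0 < d -> 0 < rho -> 0 < profile1 M d rho^2 + profile M d rho^2.
Proof.
intros HM Hd Hrho.
destruct (Req_dec (profile M d rho) 0) as [Ht|Ht].
2: { pose proof (pow2_gt_0 _ Ht). pose proof (pow2_ge_0 (profile1 M d rho)). lra. }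
assert (Er : rho = d).
{ unfold profile in Ht. assert (E : M*(rho-d) = 0).
  { replace (M*(rho-d)) with (M * (rho - d) / (1 + rho) ^ 2 * (1+rho)^2) by (field; lra). rewrite Ht. ring. }
  apply Rmult_integral in E. lra. }
assert (0 < profile1 M d rho).
{ unfold profile1. rewrite Er. apply Rdiv_lt_0_compat; [|apply pow_lt; lra]. repeat apply Rmult_lt_0_compat; lra. }
pose proof (pow_lt _ 2 H). pose proof (pow2_ge_0 (profile M d rho)). lra.
Qed.

(* Says that [2 atan (profile (r / lam))] is a strict subsolution when
   [lam' = - c lam^(1 - p)]. *)
Definition strict_profile (p c M d rho : R) : Prop :=
  let t := profile M d rho in let y := profile1 M d rho in
  c * Rpower rho p * y * Rpower (speed_ratio t y) ((2-p)/2) < excess (2-p) t y (profile2 M d rho).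

(** * The strict inequality for the profile, range by range *)

Section Regions.
Context (p c eta M d : R).
(** The size of [c] is dictated by [40/M <= rho <= 1], where the time term is at most
    [10*c*t = (2-p)*t/10] against an excess of [(2-p)*t/8]. The bound on [eta*M] makes the
    linearisation error [14400/M] at most [eta/100]. *)
Context (Hp : 1 < p < 2) (Hc : 100*c = 2-p) (Heta : 20*eta = 2-p) (HMd : eta = M*d)
  (HM : 5000 <= M) (Hd : 0 < d) (HMe : 2000000 <= eta*M).

Let Hq : 0 < 2-p < 1.
Proof. lra. Qed.
Let Hd1 : d <= 1/1000.
Proof. nra. Qed.

Lemma strict_left (rho : R) : 0 < rho <= d -> strict_profile p c M d rho.
Proof.
intros H0. unfold strict_profile. set (t := profile M d rho). set (y := profile1 M d rho).
assert (HS : 0 < y^2+t^2) by (apply profile_nondegenerate; lra).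
pose proof (inv_pow_bounds 2 rho ltac:(lra)) as B2.
pose proof (inv_pow_bounds 3 rho ltac:(lra)) as B3.
pose proof (inv_pow_bounds 4 rho ltac:(lra)) as B4. simpl INR in B2, B3, B4.
assert (Hw : 0 < M*rho <= eta).
{ split. apply Rmult_lt_0_compat; lra. rewrite HMd. apply Rmult_le_compat_l; lra. }
assert (Ht : -1/4 <= t <= 0).
{ unfold t, profile, Rdiv. assert (-1/4 <= M*(rho-d) <= 0) by lra.
  clear - B2 H H0 Hd1. split; nra. }
assert (Hy : 0 < y <= 1/4).
{ unfold y, profile1, Rdiv. assert (0 < M*rho*(1+2*d-rho) <= 1/4).
  { split. apply Rmult_lt_0_compat; lra.
    apply Rle_trans with ((1/20)*2); [|lra]. apply Rmult_le_compat; lra. }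
  clear - B3 H H0 Hd1. split; nra. }
assert (Hz : 0 <= profile2 M d rho).
{ unfold profile2, Rdiv. apply Rmult_le_pos; [|lra]. apply Rmult_le_pos; [lra|]. clear - H0 Hd1. nra. }
cut ((c * Rpower rho p * Rpower (speed_ratio t y) ((2-p)/2)) * y < excess (2-p) t y (profile2 M d rho)); [lra|].
apply excess_of_nonpos; trivial; [lra|].
pose proof (Rpower_le_id rho p ltac:(lra) ltac:(lra)) as P1.
assert (HS2 : y^2 <= 4*t^2+4) by (clear - Hy; nra).
pose proof (speed_ratio_le_5 (2-p) t y Hq HS HS2) as P2.
apply Rle_lt_trans with (c*1*5); [|lra]. apply Rmult3_le_compat; lra.
Qed.

Lemma strict_inner (rho : R) : d < rho <= 40/M -> strict_profile p c M d rho.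
Proof.
intros H0. unfold strict_profile. set (t := profile M d rho). set (y := profile1 M d rho).
assert (HS : 0 < y^2+t^2) by (apply profile_nondegenerate; lra).
assert (Hw : M*rho <= 40).
{ replace 40 with (M*(40/M)) by (field; lra). apply Rmult_le_compat_l; lra. }
assert (Hw0 : 0 < M*rho) by (apply Rmult_lt_0_compat; lra).
(* [14400 = 9*40^2], from [M*rho <= 40]. *)
assert (He : 9*rho*(M*rho) <= 14400/M).
{ apply (Rmult_le_reg_r M); [lra|]. replace (14400/M*M) with (9*(40*40)) by (field; lra).
  replace (9 * rho * (M * rho) * M) with (9*((M*rho)*(M*rho))) by ring.
  apply Rmult_le_compat_l; [lra|]. apply Rmult_le_compat; lra. }
assert (He2 : 2*d*(M*rho) <= 14400/M).
{ apply (Rmult_le_reg_r M); [lra|]. replace (14400/M*M) with 14400 by (field; lra).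
  replace (2*d*(M*rho)*M) with (2*eta*(M*rho)) by (rewrite HMd; ring).
  apply Rle_trans with (2*1*40); [|lra]. apply Rmult_le_compat; lra. }
assert (He3 : 0 < 14400/M <= eta/100).
{ split. apply Rdiv_lt_0_compat; lra. apply (Rmult_le_reg_r M); [lra|]. replace (14400/M*M) with 14400 by (field; lra). lra. }
assert (Hrs : rho <= 1/100) by (clear - Hw Hw0 HM; nra).
assert (HrM : rho*82 < eta/4*8).
{ apply (Rmult_lt_reg_l M); lra. }
set (e := 14400/M) in *. clearbody e.
destruct (profile_inner_bounds M eta d rho (M*rho) e eq_refl HMd ltac:(lra) ltac:(lra) ltac:(lra) He He2) as (T1 & T2 & T3 & T4 & T5 & T6).
fold t y in T1, T2, T3, T4, T5, T6.
pose proof (excess_inner (2-p) eta e (M*rho) t y _ Hq ltac:(lra) ltac:(lra) T1 T2 T3 T4 T5 T6) as HI.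
eapply Rlt_le_trans; [|exact HI].
assert (Hyt : y <= t + 1/10) by lra.
assert (HS2 : y^2 <= 4*t^2+4) by (assert (y^2 <= (t+1/10)^2) by (apply pow_incr; lra); pose proof (pow2_ge_0 t); pose proof (pow2_ge_0 (t-1)); lra).
pose proof (speed_ratio_le_5 (2-p) t y Hq HS HS2) as P2.
pose proof (Rpower_le_id rho p ltac:(lra) ltac:(lra)) as P1.
assert (S1 : c*Rpower rho p <= 1/100*rho) by (apply Rmult_le_compat; lra).
apply Rle_lt_trans with ((1/100*rho)*41*5); [|lra].
apply Rmult3_le_compat; try lra.
split; trivial. apply Rmult_le_pos; lra.
Qed.

Lemma strict_mid_small (rho : R) : 40/M <= rho <= 1 -> strict_profile p c M d rho.
Proof.
intros H2. unfold strict_profile. set (t := profile M d rho). set (y := profile1 M d rho).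
assert (0 < 40/M) by (apply Rdiv_lt_0_compat; lra).
assert (HS : 0 < y^2+t^2) by (apply profile_nondegenerate; lra).
destruct (excess_mid_small (2-p) eta M d rho Hq ltac:(lra) HMd Hd ltac:(lra) ltac:(lra)) as (T1 & T2 & T3).
fold t y in T1, T2, T3. eapply Rlt_le_trans; [|exact T3].
assert (HS2 : y^2 <= 4*t^2+4) by (clear - T1 T2; nra).
pose proof (speed_ratio_le_5 (2-p) t y Hq HS HS2) as P2.
pose proof (Rpower_le_id rho p ltac:(lra) ltac:(lra)) as P1.
assert (S1 : c*Rpower rho p <= c*1) by (apply Rmult_le_compat; lra).
apply Rle_lt_trans with ((c*1)*(2*t)*5).
- apply Rmult3_le_compat; try lra. split; trivial. apply Rmult_le_pos; lra.
- replace c with ((2-p)/100) by lra.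
  assert (0 < (2-p)*t) by (apply Rmult_lt_0_compat; lra). lra.
Qed.

Lemma strict_mid_large (N rho : R) : M = N^2 -> 5000 <= N -> 1 <= rho <= N -> strict_profile p c M d rho.
Proof.
intros EM HN H3. unfold strict_profile. set (t := profile M d rho). set (y := profile1 M d rho).
assert (HS : 0 < y^2+t^2) by (apply profile_nondegenerate; lra).
destruct (excess_mid_large (2-p) eta M N d rho Hq ltac:(lra) HMd Hd EM HN ltac:(lra)) as (T1 & T2 & T3).
fold t y in T1, T2, T3. eapply Rlt_le_trans; [|exact T3].
assert (Hr0 : 0 < 1/(8*rho)) by (apply Rdiv_lt_0_compat; lra).
assert (Hrt : 0 < 1/(8*rho)*t) by (apply Rmult_lt_0_compat; lra).
assert (HR : 0 < Rpower rho p) by apply exp_pos.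
assert (HG : 0 < Rpower (speed_ratio t y) ((2-p)/2)) by apply exp_pos.
destruct (Rle_dec y 0) as [Hy|Hy].
{ apply Rle_lt_trans with 0; [|exact Hrt].
  assert (0 <= c * Rpower rho p * (-y) * Rpower (speed_ratio t y) ((2-p)/2)) by (repeat apply Rmult_le_pos; lra). lra. }
assert (Hr2 : rho <= 1+2*d).
{ destruct (Rle_dec rho (1+2*d)) as [?|Hn]; trivial. exfalso. apply Hy. unfold y, profile1, Rdiv.
  assert (Hi : 0 < /(1+rho)^3) by (apply Rinv_0_lt_compat, pow_lt; lra).
  assert (HMr : 0 < M*rho) by (apply Rmult_lt_0_compat; lra).
  assert (0 <= M*rho*(rho-1-2*d)*/(1+rho)^3) by (repeat apply Rmult_le_pos; lra). lra. }
assert (HS2 : y^2 <= 4*t^2+4) by (clear - T2 Hy; nra).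
pose proof (speed_ratio_le_5 (2-p) t y Hq HS HS2) as P2.
assert (P1 : Rpower rho p <= 101/100).
{ apply Rle_trans with (Rpower rho 2). apply Rle_Rpower; lra.
  replace 2 with (INR 2) by (simpl; ring). rewrite Rpower_pow by lra. clear - Hr2 Hd1 H3. nra. }
assert (S1 : c*Rpower rho p <= 1/100*(101/100)) by (apply Rmult_le_compat; lra).
apply Rle_lt_trans with ((1/100*(101/100))*t*5).
- apply Rmult3_le_compat; try lra. split; trivial. apply Rmult_le_pos; lra.
- assert (1/10 <= 1/(8*rho)). { apply (Rmult_le_reg_r (8*rho)); [lra|]. field_simplify; lra. }
  assert (1/10*t <= 1/(8*rho)*t) by (apply Rmult_le_compat_r; lra). lra.
Qed.

(** As [y <= -t/2] and the excess is at least [-3*t], it suffices that [c*rho^p*G >= 7], with [G]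
    the power of [speed_ratio]. While [t >= 1], [t <= N] yields
    [rho^p*G >= N^p * N^(p-2) = N^(2*(p-1))], which is large because [p > 1]. Once [t < 1],
    [G >= M/(2*rho)] and [rho^p >= rho] yield [rho^p*G >= M/2]. *)
Lemma strict_tail (N rho : R) : M = N^2 -> 5000 <= N -> N <= rho ->
  7 <= c * Rpower N (2*(p-1)) -> 14 <= c*M -> strict_profile p c M d rho.
Proof.
intros EM HN H3 HcN HMc. unfold strict_profile. set (t := profile M d rho). set (y := profile1 M d rho).
destruct (excess_tail (2-p) M N d rho Hq ltac:(lra) EM HN H3) as (T1 & T2 & T3).
fold t y in T1, T2, T3. eapply Rlt_le_trans; [|exact T3].
assert (Hx : 0 < M/(2*rho)) by (apply Rdiv_lt_0_compat; lra).
assert (Ht : 0 < t) by lra.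
assert (HG : 7 <= c * (Rpower rho p * Rpower (speed_ratio t y) ((2-p)/2)) ).
{ destruct (Rle_dec 1 t) as [Ht1|Ht1].
  - assert (P1 : Rpower (/N) (2-p) <= Rpower (speed_ratio t y) ((2-p)/2)).
    { apply speed_ratio_ge; trivial. apply Rinv_0_lt_compat; lra.
      assert (HtN : t <= N).
      { destruct T1 as [_ T1]. eapply Rle_trans; [exact T1|]. apply (Rmult_le_reg_r rho); [lra|].
        unfold Rdiv. rewrite Rmult_assoc, Rinv_l, Rmult_1_r, EM by lra. simpl. rewrite Rmult_1_r. apply Rmult_le_compat_l; lra. }
      apply (Rmult_le_reg_l N); [lra|]. rewrite <- Rmult_assoc, Rinv_r by lra. clear - HtN Ht1. nra. }
    assert (P2 : Rpower N p <= Rpower rho p) by (apply Rle_Rpower_l; lra).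
    eapply Rle_trans; [exact HcN|]. apply Rmult_le_compat_l; [lra|].
    replace (Rpower N (2*(p-1))) with (Rpower N p * Rpower (/N) (2-p)).
    + apply Rmult_le_compat; trivial; left; apply exp_pos.
    + unfold Rpower. rewrite ln_Rinv by lra. rewrite <- exp_plus. f_equal. ring.
  - set (x := M/(2*rho)) in *.
    assert (P1 : x <= Rpower (speed_ratio t y) ((2-p)/2)).
    { apply Rle_trans with (Rpower x (2-p)). apply Rpower_ge_id; lra.
      apply speed_ratio_ge; trivial. assert (Hxt : x <= t) by lra. clear - Hxt Ht Ht1 Hx. nra. }
    assert (P2 : rho <= Rpower rho p).
    { pose proof (Rle_Rpower rho 1 p) as H. rewrite Rpower_1 in H by lra. apply H; lra. }
    apply Rle_trans with (c*(rho*x)).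
    + replace (c*(rho*x)) with (c*M/2). lra. unfold x. field. lra.
    + apply Rmult_le_compat_l; [lra|]. apply Rmult_le_compat; lra. }
set (G := Rpower rho p * Rpower (speed_ratio t y) ((2-p)/2)) in *.
replace (c * Rpower rho p * y * Rpower (speed_ratio t y) ((2-p)/2)) with (c*G*y) by (unfold G; ring).
set (cG := c*G) in *. clearbody cG. clear - HG T2 Ht. nra.
Qed.
End Regions.

Lemma strict_profile_exists (p : R) : 1 < p < 2 ->
  exists c M d, 0 < c /\ 5000 <= M /\ 0 < d <= 1/10 /\ forall rho, 0 < rho -> strict_profile p c M d rho.
Proof.
intros Hp.
set (c := (2-p)/100). set (eta := (2-p)/20).
assert (Hc : 0 < c) by (unfold c; lra). assert (Heta : 0 < eta) by (unfold eta; lra).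
assert (HC0 : 0 < 7/c) by (apply Rdiv_lt_0_compat; unfold c; lra).
(* One summand per demand: the numerical bounds, [eta*M >= 2000000] and [c*M >= 14] (both through
   [N <= M]), and [c*N^(2*(p-1)) >= 7]. *)
set (N := 5000 + 2000000/eta + 14/c + Rpower (7/c) (/(2*(p-1)))).
assert (HN : 5000 <= N /\ 2000000/eta <= N /\ 14/c <= N /\ Rpower (7/c) (/(2*(p-1))) <= N).
{ assert (0 < 2000000/eta) by (apply Rdiv_lt_0_compat; lra).
  assert (0 < 14/c) by (apply Rdiv_lt_0_compat; lra).
  assert (0 < Rpower (7/c) (/(2*(p-1)))) by apply exp_pos. unfold N. lra. }
destruct HN as (HN1 & HN2 & HN3 & HN4). clearbody N.
assert (HN5 : 7/c <= Rpower N (2*(p-1))).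
{ apply Rle_trans with (Rpower (Rpower (7/c) (/(2*(p-1)))) (2*(p-1))).
  rewrite Rpower_mult, Rinv_l, Rpower_1 by lra. lra.
  apply Rle_Rpower_l. lra. split; trivial. apply exp_pos. }
set (M := N^2). set (d := eta/M).
assert (HMN : N <= M) by (unfold M; nra).
assert (HMe : 2000000 <= eta * M).
{ replace 2000000 with (eta*(2000000/eta)) by (field; lra). apply Rmult_le_compat_l; lra. }
assert (HMc : 14 <= c * M).
{ replace 14 with (c*(14/c)) by (field; lra). apply Rmult_le_compat_l; lra. }
assert (HcN : 7 <= c * Rpower N (2*(p-1))).
{ replace 7 with (c*(7/c)) by (field; lra). apply Rmult_le_compat_l; lra. }
assert (HMd : eta = M*d) by (unfold d; field; lra).
assert (Hd : 0 < d) by (unfold d; apply Rdiv_lt_0_compat; lra).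
assert (Hc' : 100*c = 2-p) by (unfold c; field). assert (He' : 20*eta = 2-p) by (unfold eta; field).
exists c, M, d. split; [lra|]. split; [lra|]. split. { split; trivial. clear - HMd HMN HN1 He' Hp Hd. nra. }
intros rho Hrho.
destruct (Rle_dec rho d); [apply (strict_left p c eta); lra|].
destruct (Rle_dec rho (40/M)); [apply (strict_inner p c eta); lra|].
destruct (Rle_dec rho 1); [apply (strict_mid_small p c eta); lra|].
destruct (Rle_dec rho N); [apply (strict_mid_large p c eta M d) with N; unfold M in *; lra|].
apply (strict_tail p c eta M d) with N; unfold M in *; lra.
Qed.


(** * The self-similar subsolution *)

Lemma sin_2atan (t : R) : sin (2 * atan t) = 2*t/(1+t^2).
Proof.
rewrite sin_2a, sin_atan, cos_atan.
pose proof (one_plus_sq t). rewrite Rsqr_pow2.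
assert (Hs : sqrt (1+t^2) * sqrt (1+t^2) = 1+t^2) by (apply sqrt_sqrt; lra).
assert (0 < sqrt (1+t^2)) by (apply sqrt_lt_R0; lra).
rewrite <- Hs at 3. field. lra.
Qed.

Lemma cos_2atan (t : R) : cos (2 * atan t) = (1-t^2)/(1+t^2).
Proof.
rewrite cos_2a, sin_atan, cos_atan.
pose proof (one_plus_sq t). rewrite Rsqr_pow2.
assert (Hs : sqrt (1+t^2) * sqrt (1+t^2) = 1+t^2) by (apply sqrt_sqrt; lra).
assert (0 < sqrt (1+t^2)) by (apply sqrt_lt_R0; lra).
rewrite <- Hs at 5. field. lra.
Qed.

Lemma profile_derive (M d rho : R) : 0 < rho -> is_derive (profile M d) rho (profile1 M d rho / rho).
Proof. intros H. unfold profile, profile1. auto_derive. nra. field. lra. Qed.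

Lemma profile1_derive (M d rho : R) : 0 < rho -> is_derive (profile1 M d) rho (profile2 M d rho / rho).
Proof. intros H. unfold profile1, profile2. auto_derive. assert (0 < (1+rho)^3) by (apply pow_lt; lra). nra. field. lra. Qed.

(** [speed] and [accel] are the first two derivatives of [2 * atan (profile rho)] in [log rho]; in
    terms of the barrier they are [r f_r] and [r f_r + r^2 f_rr]. *)
Definition speed (M d rho : R) := 2 * profile1 M d rho / (1 + profile M d rho ^ 2).
Definition accel (M d rho : R) := 2 * profile2 M d rho / (1 + profile M d rho ^ 2)
  - 4 * profile M d rho * profile1 M d rho ^ 2 / (1 + profile M d rho ^ 2)^2.

Lemma angle_derive (M d rho : R) : 0 < rho -> is_derive (fun x => 2 * atan (profile M d x)) rho (speed M d rho / rho).
Proof.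
intros H. pose proof (profile_derive M d rho H) as H0.
evar_last. auto_derive. exists (profile1 M d rho / rho). exact H0.
replace (Derive (fun x => profile M d x) rho) with (profile1 M d rho / rho) by (symmetry; now apply is_derive_unique).
reflexivity.
unfold speed. pose proof (one_plus_sq (profile M d rho)). field. lra.
Qed.

Lemma vel_derive (M d rho : R) : 0 < rho -> is_derive (speed M d) rho (accel M d rho / rho).
Proof.
intros H. pose proof (profile_derive M d rho H) as H0. pose proof (profile1_derive M d rho H) as H1.
pose proof (one_plus_sq (profile M d rho)).
unfold speed.
evar_last. auto_derive. repeat split; first [now exists (profile1 M d rho / rho) | now exists (profile2 M d rho / rho) | simpl in *; lra].
replace (Derive (fun x => profile M d x) rho) with (profile1 M d rho / rho) by (symmetry; now apply is_derive_unique).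
replace (Derive (fun x => profile1 M d x) rho) with (profile2 M d rho / rho) by (symmetry; now apply is_derive_unique).
reflexivity.
unfold accel. field. lra.
Qed.

Lemma barrier_derive_r (M d lam r : R) : 0 < lam -> 0 < r ->
  is_derive (fun x => 2 * atan (profile M d (x/lam))) r (speed M d (r/lam) / r).
Proof.
intros Hl Hr. assert (0 < r/lam) by (apply Rdiv_lt_0_compat; lra).
evar_last. apply (is_derive_comp (fun x => 2 * atan (profile M d x)) (fun x => x/lam)).
now apply angle_derive. auto_derive; [trivial | reflexivity].
unfold scal; simpl; unfold mult; simpl. field. lra.
Qed.

Lemma barrier_derive_rr (M d lam r : R) : 0 < lam -> 0 < r ->
  is_derive (fun x => speed M d (x/lam) / x) r ((accel M d (r/lam) - speed M d (r/lam)) / r^2).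
Proof.
intros Hl Hr. assert (0 < r/lam) by (apply Rdiv_lt_0_compat; lra).
assert (H1 : is_derive (fun x => speed M d (x/lam)) r (accel M d (r/lam) / r)).
{ evar_last. apply (is_derive_comp (speed M d) (fun x => x/lam)).
  now apply vel_derive. auto_derive; [trivial | reflexivity].
  unfold scal; simpl; unfold mult; simpl. field. lra. }
evar_last. apply (is_derive_div (fun x => speed M d (x/lam)) (fun x => x)). exact H1. apply @is_derive_id. lra.
unfold one; simpl. field. lra.
Qed.

(** In terms of [mu = lam^p] the law of the scale is linear, [mu' = -p c], and
    [lam'/lam = -c/mu]. *)
Lemma barrier_derive_t (M d r p c mu0 t : R) : 0 < p -> 0 < r -> 0 < mu0 - p*c*t ->
  is_derive (fun s => 2 * atan (profile M d (r / Rpower (mu0 - p*c*s) (/p)))) t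
    (speed M d (r / Rpower (mu0 - p*c*t) (/p)) * c / (mu0 - p*c*t)).
Proof.
intros Hp Hr Hmu. set (lam := Rpower (mu0 - p*c*t) (/p)).
assert (0 < lam) by apply exp_pos.
assert (0 < r/lam) by (apply Rdiv_lt_0_compat; lra).
evar_last. apply (is_derive_comp (fun x => 2 * atan (profile M d x)) (fun s => r / Rpower (mu0 - p*c*s) (/p))).
now apply angle_derive.
unfold Rpower. auto_derive. split; trivial. split; trivial. apply Rgt_not_eq, exp_pos.
reflexivity.
unfold scal; simpl; unfold mult; simpl. 
fold (Rpower (mu0 + - (p*c*t)) (/p)). replace (mu0 + - (p*c*t)) with (mu0 - p*c*t) by ring. fold lam. field. lra.
Qed.

(** [J] is [speed_ratio / r^2], and [A] has [speed_ratio] as a factor; since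
    [(p-4)/2 = -(2-p)/2 - 1], this factor cancels one power of it. The powers of [r] combine to
    [r^(-p)]. *)
Lemma F_profile (p r t y z : R) : 0 < r -> 0 < y^2+t^2 ->
  let W := 1+t^2 in
  F p r (2*atan t) (2*y/W/r) ((2*z/W-4*t*y^2/W^2 - 2*y/W)/r^2) =
  2/W * / Rpower r p * / Rpower (speed_ratio t y) ((2-p)/2) * excess (2-p) t y z.
Proof.
intros Hr HS W. pose proof (one_plus_sq t) as HW. fold W in HW.
unfold F.
assert (HX : 0 < speed_ratio t y). { unfold speed_ratio. apply Rdiv_lt_0_compat. lra. now apply pow_lt. }
assert (EJ : J r (2*atan t) (2*y/W/r) = speed_ratio t y * / r^2).
{ unfold J. rewrite sin_2atan. unfold speed_ratio. fold W. field. lra. }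
rewrite EJ.
assert (EA : A p r (2*atan t) (2*y/W/r) ((2*z/W-4*t*y^2/W^2 - 2*y/W)/r^2) =
  2/W*speed_ratio t y*excess (2-p) t y z/r^4).
{ unfold A. rewrite sin_2atan, cos_2atan. unfold speed_ratio, excess. fold W. unfold W. field. 
  unfold W in HW. repeat split; lra. }
rewrite EA.
assert (E2 : Rpower (speed_ratio t y * / r^2) ((p-4)/2) = / (Rpower (speed_ratio t y) ((2-p)/2) * speed_ratio t y) * (r^4 * / Rpower r p)).
{ rewrite <- Rpower_mult_distr by (trivial; apply Rinv_0_lt_compat, pow_lt; lra).
  f_equal.
  - replace ((p-4)/2) with (- ((2-p)/2 + 1)) by field. rewrite Rpower_Ropp, Rpower_plus, Rpower_1 by trivial. reflexivity.
  - rewrite <- (Rpower_pow 4 r Hr), <- (Rpower_pow 2 r Hr), <- !Rpower_Ropp, Rpower_mult, <- Rpower_plus. f_equal. simpl. field. }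
rewrite E2. 
assert (0 < Rpower r p) by apply exp_pos.
assert (0 < Rpower (speed_ratio t y) ((2-p)/2)) by apply exp_pos.
field. lra.
Qed.

(** This is the profile inequality times the positive prefactor of [F_profile], because
    [rho^p = r^p/mu]. *)
Lemma profile_subsolution (p c M d mu r : R) : 0 < p -> 0 < mu -> 0 < r -> 0 < M -> 0 < d ->
  let rho := r / Rpower mu (/p) in 
  strict_profile p c M d rho ->
  speed M d rho * c / mu < F p r (2 * atan (profile M d rho)) (speed M d rho / r) ((accel M d rho - speed M d rho) / r^2).
Proof.
intros Hp Hmu Hr HM Hd rho HC.
assert (Hl : 0 < Rpower mu (/p)) by apply exp_pos.
assert (Hrho : 0 < rho) by (apply Rdiv_lt_0_compat; lra).
pose proof (profile_nondegenerate M d rho HM Hd Hrho) as HS.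
unfold speed, accel. rewrite F_profile by trivial.
unfold strict_profile in HC.
assert (E : Rpower rho p = Rpower r p / mu).
{ unfold rho, Rdiv. rewrite <- Rpower_mult_distr by (trivial; now apply Rinv_0_lt_compat). f_equal.
  rewrite <- Rpower_Ropp, Rpower_mult. replace (- / p * p) with (Ropp 1) by (field; lra). rewrite Rpower_Ropp, Rpower_1; trivial. }
rewrite E in HC.
pose proof (one_plus_sq (profile M d rho)) as HW.
assert (HP : 0 < Rpower r p) by apply exp_pos.
set (X := Rpower (speed_ratio (profile M d rho) (profile1 M d rho)) ((2-p)/2)) in *.
assert (HX : 0 < X) by apply exp_pos.
set (W := 1 + profile M d rho^2) in *.
assert (Hk : 0 < 2/W * / Rpower r p * / X).
{ repeat apply Rmult_lt_0_compat; try apply Rinv_0_lt_compat; lra. }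
apply Rmult_lt_compat_l with (1:=Hk) in HC.
eapply Rle_lt_trans; [|exact HC]. right. field. lra.
Qed.


(** * One-sided derivatives and first contact *)

Lemma is_derive_in_eps (a b : R) (f : R -> R) (x l : R) :
  is_derive_in a b f x l <->
  forall eps, 0 < eps -> exists delta, 0 < delta /\ forall y, a <= y <= b -> y <> x ->
    Rabs (y-x) < delta -> Rabs ((f y - f x)/(y-x) - l) < eps.
Proof.
split.
- intros H eps Heps.
  destruct (H (fun v => Rabs (v - l) < eps)) as [delta Hd].
  { exists (mkposreal eps Heps). intros v Hv. exact Hv. }
  exists delta. split. apply cond_pos. intros y Hy Hyx Hyd. now apply Hd.
- intros H P [eps HP].
  destruct (H eps (cond_pos eps)) as [delta [Hd HH]].
  exists (mkposreal delta Hd). intros y Hy Hyx Hyab. apply HP. now apply HH.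
Qed.

Lemma is_derive_is_derive_in (a b : R) (f : R -> R) (x l : R) :
  is_derive f x l -> is_derive_in a b f x l.
Proof.
intros H. apply is_derive_in_eps. intros eps Heps. apply is_derive_Reals in H.
destruct (H eps Heps) as [delta Hd]. exists delta. split. apply cond_pos.
intros y _ Hyx Hyd. specialize (Hd (y-x)). replace (x+(y-x)) with y in Hd by ring. apply Hd; [lra|trivial].
Qed.

Lemma is_derive_in_is_derive (a b : R) (f : R -> R) (x l : R) : a < x < b ->
  is_derive_in a b f x l -> is_derive f x l.
Proof.
intros Hx H. apply is_derive_Reals. intros eps Heps. rewrite is_derive_in_eps in H.
destruct (H eps Heps) as [delta [Hd HH]].
assert (H0 : 0 < Rmin delta (Rmin (x-a) (b-x))) by (repeat apply Rmin_glb_lt; lra).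
exists (mkposreal _ H0). intros h Hh Hhd. simpl in Hhd.
pose proof (Rmin_l delta (Rmin (x-a) (b-x))). pose proof (Rmin_r delta (Rmin (x-a) (b-x))).
pose proof (Rmin_l (x-a) (b-x)). pose proof (Rmin_r (x-a) (b-x)).
assert (Rabs h < x-a /\ Rabs h < b-x) by lra.
pose proof (Rle_abs h). pose proof (Rle_abs (-h)) as Habs. rewrite Rabs_Ropp in Habs.
specialize (HH (x+h)). replace (x+h-x) with h in HH by ring. apply HH; lra.
Qed.

Lemma is_derive_in_minus (a b : R) (f g : R -> R) (x l m : R) :
  is_derive_in a b f x l -> is_derive_in a b g x m -> is_derive_in a b (fun y => f y - g y) x (l-m).
Proof.
rewrite !is_derive_in_eps. intros Hf Hg eps Heps.
destruct (Hf (eps/2)) as [d1 [Hd1 H1]]; [lra|]. destruct (Hg (eps/2)) as [d2 [Hd2 H2]]; [lra|].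
exists (Rmin d1 d2). split. now apply Rmin_glb_lt. intros y Hy Hyx Hyd.
pose proof (Rmin_l d1 d2). pose proof (Rmin_r d1 d2).
specialize (H1 y Hy Hyx ltac:(lra)). specialize (H2 y Hy Hyx ltac:(lra)).
replace ((f y - g y - (f x - g x))/(y-x) - (l-m)) with (((f y - f x)/(y-x) - l) - ((g y - g x)/(y-x) - m)) by (field; lra).
eapply Rle_lt_trans; [apply Rabs_triang|]. rewrite Rabs_Ropp. lra.
Qed.

Lemma is_derive_in_nonpos_left (a b : R) (f : R -> R) (x l : R) : a < x <= b ->
  is_derive_in a b f x l -> (forall y, a <= y < x -> f x <= f y) -> l <= 0.
Proof.
intros Hx H Hf. rewrite is_derive_in_eps in H. apply Rnot_lt_le. intros Hl.
destruct (H l Hl) as [d [Hd HH]].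
set (y := Rmax a (x-d/2)).
assert (Hy : a <= y < x /\ x-d/2 <= y).
{ unfold y. repeat split. apply Rmax_l. apply Rmax_lub_lt; lra. apply Rmax_r. }
specialize (HH y ltac:(lra) ltac:(lra)). rewrite Rabs_left in HH by lra. specialize (HH ltac:(lra)).
apply Rabs_def2 in HH. specialize (Hf y ltac:(lra)).
assert (HQ : 0 < (f y - f x)/(y-x)) by lra.
assert (E : f y - f x = ((f y - f x)/(y-x))*(y-x)) by (field; lra).
set (Q := (f y - f x)/(y-x)) in *. clearbody Q. nra.
Qed.

Lemma is_derive_in_nonneg_right (a b : R) (f : R -> R) (x l : R) : a <= x < b ->
  is_derive_in a b f x l -> (forall y, x < y <= b -> f x <= f y) -> 0 <= l.
Proof.
intros Hx H Hf. rewrite is_derive_in_eps in H. apply Rnot_lt_le. intros Hl.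
destruct (H (-l)) as [d [Hd HH]]; [lra|].
set (y := Rmin b (x+d/2)).
assert (Hy : x < y <= b /\ y <= x+d/2).
{ unfold y. repeat split. apply Rmin_glb_lt; lra. apply Rmin_l. apply Rmin_r. }
specialize (HH y ltac:(lra) ltac:(lra)). rewrite Rabs_right in HH by lra. specialize (HH ltac:(lra)).
apply Rabs_def2 in HH. specialize (Hf y ltac:(lra)).
assert (HQ : (f y - f x)/(y-x) < 0) by lra.
assert (E : f y - f x = ((f y - f x)/(y-x))*(y-x)) by (field; lra).
set (Q := (f y - f x)/(y-x)) in *. clearbody Q. nra.
Qed.

(** Were [w2] negative, [w1], which is zero at [x], would be negative just to the right of [x], and
    the mean value theorem would take [w] below its minimum. *)
Lemma interior_min (a b : R) (w w1 : R -> R) (x w2 : R) : a < x < b ->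
  (forall y, a < y < b -> is_derive w y (w1 y)) -> is_derive w1 x w2 ->
  (forall y, a <= y <= b -> w x <= w y) -> w1 x = 0 /\ 0 <= w2.
Proof.
intros Hx Hw Hw1 Hmin.
assert (H0 : w1 x = 0).
{ pose proof (is_derive_is_derive_in a b _ _ _ (Hw x Hx)) as H.
  apply Rle_antisym.
  - apply (is_derive_in_nonpos_left a b w x); trivial. lra. intros y Hy. apply Hmin; lra.
  - apply (is_derive_in_nonneg_right a b w x); trivial. lra. intros y Hy. apply Hmin; lra. }
split; trivial. apply Rnot_lt_le. intros Hl.
pose proof (is_derive_is_derive_in a b _ _ _ Hw1) as H. rewrite is_derive_in_eps in H.
destruct (H (-w2)) as [d [Hd HH]]; [lra|].
set (y := Rmin ((x+b)/2) (x+d/2)).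
assert (Hy : x < y < b /\ y < x+d).
{ unfold y. pose proof (Rmin_l ((x+b)/2) (x+d/2)). pose proof (Rmin_r ((x+b)/2) (x+d/2)).
  repeat split; try lra. apply Rmin_glb_lt; lra. }
destruct (MVT_cor2 w w1 x y) as [c [Ec Hc]]; [lra| |].
{ intros c Hc. apply is_derive_Reals, Hw; lra. }
assert (Hm := Hmin y ltac:(lra)).
specialize (HH c ltac:(lra) ltac:(lra)). rewrite Rabs_right in HH by lra. specialize (HH ltac:(lra)).
apply Rabs_def2 in HH. rewrite H0 in HH.
assert (E : w1 c = ((w1 c - 0)/(c-x))*(c-x)) by (field; lra).
set (Q := (w1 c - 0)/(c-x)) in *. clearbody Q.
assert (w1 c < 0) by nra. nra.
Qed.

Lemma continuous_on_rect_eps (T : R) (D : R -> R -> R) : continuous_on_rect T D ->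
  forall t r, 0 <= t <= T -> 0 <= r <= 1 -> forall eps, 0 < eps -> exists delta, 0 < delta /\
  forall s x, 0 <= s <= T -> 0 <= x <= 1 -> Rabs (s-t) < delta -> Rabs (x-r) < delta ->
  Rabs (D s x - D t r) < eps.
Proof.
intros H t r Ht Hr eps Heps.
destruct (H (t,r) (conj Ht Hr) (fun v => Rabs (v - D t r) < eps)) as [delta Hd].
{ exists (mkposreal eps Heps). intros v Hv. exact Hv. }
exists delta. split. apply cond_pos. intros s x Hs Hx Hst Hxr. apply (Hd (s,x)); split; trivial.
Qed.

(* A function that is positive at time 0 and loses positivity does so through
   a first zero, which is a spatial minimum. *)
Lemma first_contact (T : R) (D : R -> R -> R) : 0 < T -> continuous_on_rect T D ->
  (forall r, 0 <= r <= 1 -> 0 < D 0 r) ->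
  (forall t r, 0 < t <= T -> 0 <= r <= 1 -> D t r = 0 ->
     (forall x, 0 <= x <= 1 -> 0 <= D t x) -> (forall s, 0 <= s < t -> 0 < D s r) -> False) ->
  forall t r, 0 <= t <= T -> 0 <= r <= 1 -> 0 < D t r.
Proof.
intros HT HD H0 Hno.
pose proof (continuous_on_rect_eps T D HD) as Hc.
set (P := fun t => forall s r, 0 <= s <= t -> 0 <= r <= 1 -> 0 < D s r).
set (E := fun t => 0 <= t <= T /\ P t).
destruct (completeness E) as [m [Hub Hlub]].
{ exists T. intros t [Ht _]. lra. }
{ exists 0. split. lra. intros s r Hs Hr. replace s with 0 by lra. now apply H0. }
assert (Hm : 0 <= m <= T).
{ split. apply Hub. split. lra. intros s r Hs Hr. replace s with 0 by lra. now apply H0.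
  apply Hlub. intros t [Ht _]. lra. }
assert (Hbefore : forall s r, 0 <= s < m -> 0 <= r <= 1 -> 0 < D s r).
{ intros s r Hs Hr. apply NNPP. intros Hn. assert (m <= s); [|lra].
  apply Hlub. intros t [Ht HP]. apply Rnot_lt_le. intros Hst. apply Hn. apply HP; lra. }
assert (Hm0 : forall r, 0 <= r <= 1 -> 0 < D m r).
{ destruct (Req_dec m 0) as [->|Hmz]; trivial.
  assert (Hge : forall r, 0 <= r <= 1 -> 0 <= D m r).
  { intros r Hr. apply Rnot_lt_le. intros Hneg.
    destruct (Hc m r Hm Hr (- D m r)) as [d [Hd HH]]; [lra|].
    set (s := Rmax 0 (m-d/2)).
    assert (Hs : 0 <= s < m /\ m-d/2 <= s).
    { unfold s. repeat split. apply Rmax_l. apply Rmax_lub_lt; lra. apply Rmax_r. }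
    specialize (HH s r ltac:(lra) Hr). rewrite Rabs_left in HH by lra.
    replace (r-r) with 0 in HH by ring. rewrite Rabs_R0 in HH. specialize (HH ltac:(lra) Hd).
    apply Rabs_def2 in HH. specialize (Hbefore s r ltac:(lra) Hr). lra. }
  intros r Hr. destruct (Rle_lt_or_eq_dec _ _ (Hge r Hr)) as [?|Heq]; trivial.
  exfalso. apply (Hno m r); trivial. lra. now symmetry. intros s Hs. now apply Hbefore. }
(* By compactness of [[0,1]], positivity at time [m] persists for a time uniform in [r], so a
   smaller [m] would not be an upper bound. *)
assert (HmT : m = T).
{ apply NNPP. intros HmT.
  assert (Hloc : forall r, exists d : posreal, 0 <= r <= 1 -> forall s x, 0 <= s <= T -> 0 <= x <= 1 ->
     Rabs (s-m) < d -> Rabs (x-r) < d -> 0 < D s x).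
  { intros r. destruct (classic (0 <= r <= 1)) as [Hr|Hr]; [|now exists (mkposreal 1 Rlt_0_1)].
    destruct (Hc m r Hm Hr (D m r) (Hm0 r Hr)) as [d [Hd HH]]. exists (mkposreal d Hd).
    intros _ s x Hs Hx H1 H2. specialize (HH s x Hs Hx H1 H2). apply Rabs_def2 in HH. lra. }
  set (delta := fun r => proj1_sig (constructive_indefinite_description _ (Hloc r))).
  destruct (compactness_value_1d 0 1 delta) as [d Hd].
  set (m' := Rmin T (m+d/2)).
  assert (Hm' : m < m' <= T /\ m' <= m + d/2).
  { unfold m'. pose proof (cond_pos d). repeat split. apply Rmin_glb_lt; lra. apply Rmin_l. apply Rmin_r. }
  assert (m' <= m); [|lra]. apply Hub. split. lra. intros s x Hs Hx.
  destruct (Rlt_dec s m) as [Hsm|Hsm]. apply Hbefore; lra.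
  apply NNPP. intros Hn. apply (Hd x Hx). intros [r [Hr [Hxr Hdr]]]. apply Hn.
  unfold delta in *. destruct (constructive_indefinite_description _ (Hloc r)) as [dr HH]. simpl in *.
  apply (HH Hr); trivial. lra. rewrite Rabs_right by lra. pose proof (cond_pos d). lra. }
subst m. intros t r Ht Hr. destruct (Req_dec t T) as [->|Hn]; [now apply Hm0 | apply Hbefore; lra].
Qed.


(** * Comparison and blow-up *)

(** Degenerate ellipticity: the coefficient of [u2] in [A] is [(p-1)*u1^2 + (sin u)^2/r^2]. *)
Lemma F_mono (p r u u1 u2 u2' : R) : 1 < p -> u2 <= u2' -> F p r u u1 u2 <= F p r u u1 u2'.
Proof.
intros Hp Hu. unfold F. apply Rmult_le_compat_l; [left; apply exp_pos|]. unfold A.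
assert (0 <= (p-1)*u1^2*(u2'-u2)) 
  by (apply Rmult_le_pos; [apply Rmult_le_pos; [lra | apply pow2_ge_0] | lra]).
assert (0 <= (u2'-u2)*((sin u)^2/r^2)).
{ apply Rmult_le_pos; [lra|]. unfold Rdiv. rewrite <- pow_inv. rewrite <- Rpow_mult_distr. apply pow2_ge_0. }
unfold Rdiv in *. lra.
Qed.

(** The factor [r^p] clears all negative powers of [r], so that the right-hand side has a limit at
    [r = 0] as soon as [sin u] does not tend to 0. *)
Lemma F_scaled (p r u u1 u2 : R) : 0 < r -> 0 < (r*u1)^2 + (sin u)^2 ->
  Rpower r p * F p r u u1 u2 = Rpower ((r*u1)^2 + (sin u)^2) ((p-4)/2) *
   ((p-1)*u1^2*u2*r^4 + (p-3)*(u1^2*sin u*cos u*r^2 - u1*(sin u)^2*r) + u1^3*r^3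
    + u2*(sin u)^2*r^2 - (sin u)^3*cos u).
Proof.
intros Hr HK. unfold F. set (K := (r*u1)^2 + (sin u)^2) in *.
assert (EJ : J r u u1 = K * / r^2) by (unfold J, K; field; lra).
rewrite EJ.
assert (E : Rpower (K * / r^2) ((p-4)/2) = Rpower K ((p-4)/2) * (r^4 * / Rpower r p)).
{ rewrite <- Rpower_mult_distr by (trivial; apply Rinv_0_lt_compat, pow_lt; lra).
  f_equal. rewrite <- (Rpower_pow 4 r Hr), <- (Rpower_pow 2 r Hr), <- !Rpower_Ropp, Rpower_mult, <- Rpower_plus.
  f_equal. simpl. field. }
rewrite E. unfold A. assert (0 < Rpower r p) by apply exp_pos. field. lra.
Qed.

Lemma is_lim_seq_pow (u : nat -> R) (l : R) (k : nat) : is_lim_seq u l -> is_lim_seq (fun n => u n ^ k) (l^k).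
Proof.
intros Hu. induction k as [|k IH]; simpl. apply is_lim_seq_const. now apply is_lim_seq_mult'.
Qed.

Ltac lim_seq := lazymatch goal with
  | |- is_lim_seq (fun n => @?f n + @?g n) _ => apply (is_lim_seq_plus' f g); lim_seq
  | |- is_lim_seq (fun n => @?f n - @?g n) _ => apply (is_lim_seq_minus' f g); lim_seq
  | |- is_lim_seq (fun n => @?f n * @?g n) _ => apply (is_lim_seq_mult' f g); lim_seq
  | |- is_lim_seq (fun n => @?f n ^ ?k) _ => apply (is_lim_seq_pow f); lim_seq
  | |- is_lim_seq (fun _ => ?c) _ => apply (is_lim_seq_const c)
  | |- _ => assumption
  end.

(* [r^p F] tends to [- sin^3 a cos a |sin a|^(p - 4)] when [sin a <> 0], while
   it tends to 0 when [F] has a finite limit. *)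
Lemma F_limit_sin2 (p : R) (u u1 u2 : R -> R) (a b e L : R) : 1 < p ->
  filterlim u (at_right 0) (locally a) -> filterlim u1 (at_right 0) (locally b) ->
  filterlim u2 (at_right 0) (locally e) ->
  filterlim (fun r => F p r (u r) (u1 r) (u2 r)) (at_right 0) (locally L) -> sin (2*a) = 0.
Proof.
intros Hp Hu Hu1 Hu2 HF.
destruct (Req_dec (sin a) 0) as [Hs|Hs]; [rewrite sin_2a, Hs; ring|].
set (rn := fun n => / (INR n + 1)).
assert (Hrn : forall n, 0 < rn n <= 1).
{ intros n. apply inv_le_1. pose proof (pos_INR n). lra. }
assert (Lr : is_lim_seq rn 0).
{ change (Finite 0) with (Rbar_inv p_infty). apply is_lim_seq_inv; [|easy].
  eapply is_lim_seq_plus. apply is_lim_seq_INR. apply is_lim_seq_const. reflexivity. }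
assert (Lr' : filterlim rn eventually (at_right 0)).
{ intros P HP. destruct HP as [d Hd].
  assert (HB : eventually (fun n => ball 0 d (rn n))). { apply Lr. exists d. trivial. }
  destruct HB as [n1 HB]. exists n1. intros n Hn. apply Hd. now apply HB. apply Hrn. }
assert (Lu : is_lim_seq (fun n => u (rn n)) a) by (eapply filterlim_comp; [exact Lr'|exact Hu]).
assert (Lu1 : is_lim_seq (fun n => u1 (rn n)) b) by (eapply filterlim_comp; [exact Lr'|exact Hu1]).
assert (Lu2 : is_lim_seq (fun n => u2 (rn n)) e) by (eapply filterlim_comp; [exact Lr'|exact Hu2]).
assert (LF : is_lim_seq (fun n => F p (rn n) (u (rn n)) (u1 (rn n)) (u2 (rn n))) L)
  by (apply (filterlim_comp _ _ _ rn (fun r => F p r (u r) (u1 r) (u2 r)) _ _ _ Lr' HF)).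
assert (Ls : is_lim_seq (fun n => sin (u (rn n))) (sin a)).
{ apply (is_lim_seq_continuous sin); trivial. apply continuity_sin. }
assert (Lc : is_lim_seq (fun n => cos (u (rn n))) (cos a)).
{ apply (is_lim_seq_continuous cos); trivial. apply continuity_cos. }
assert (LK : is_lim_seq (fun n => (rn n * u1 (rn n))^2 + sin (u (rn n))^2) (sin a ^ 2)).
{ replace (sin a ^2) with ((0*b)^2 + sin a^2) by ring. lim_seq. }
assert (HS2 : 0 < sin a^2) by (now apply pow2_gt_0).
assert (LP : is_lim_seq (fun n => Rpower ((rn n * u1 (rn n))^2 + sin (u (rn n))^2) ((p-4)/2)) (Rpower (sin a^2) ((p-4)/2))).
{ apply (is_lim_seq_continuous (fun x => Rpower x ((p-4)/2))); trivial.
  apply continuity_pt_filterlim, (ex_derive_continuous (fun x => Rpower x ((p-4)/2))).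
  unfold Rpower. auto_derive. trivial. }
assert (LB : is_lim_seq (fun n => Rpower ((rn n * u1 (rn n))^2 + sin (u (rn n))^2) ((p-4)/2) *
   ((p-1)*u1 (rn n)^2*u2 (rn n)*rn n^4 + (p-3)*(u1 (rn n)^2*sin (u (rn n))*cos (u (rn n))*rn n^2 - u1 (rn n)*(sin (u (rn n)))^2*rn n) + u1 (rn n)^3*rn n^3
    + u2 (rn n)*(sin (u (rn n)))^2*rn n^2 - (sin (u (rn n)))^3*cos (u (rn n)))) (Rpower (sin a^2) ((p-4)/2) *
   ((p-1)*b^2*e*0^4 + (p-3)*(b^2*sin a*cos a*0^2 - b*(sin a)^2*0) + b^3*0^3
    + e*(sin a)^2*0^2 - (sin a)^3*cos a))).
{ lim_seq. }
assert (LR : is_lim_seq (fun n => Rpower (rn n) p * F p (rn n) (u (rn n)) (u1 (rn n)) (u2 (rn n))) (0*L)).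
{ apply is_lim_seq_mult'; trivial.
  apply is_lim_seq_le_le with (u := fun _ => 0) (w := rn); trivial. 2: apply is_lim_seq_const.
  intros n. pose proof (Rpower_le_id (rn n) p ltac:(lra) (Hrn n)). lra. }
assert (LR' : is_lim_seq (fun n => Rpower ((rn n * u1 (rn n))^2 + sin (u (rn n))^2) ((p-4)/2) *
   ((p-1)*u1 (rn n)^2*u2 (rn n)*rn n^4 + (p-3)*(u1 (rn n)^2*sin (u (rn n))*cos (u (rn n))*rn n^2 - u1 (rn n)*(sin (u (rn n)))^2*rn n) + u1 (rn n)^3*rn n^3
    + u2 (rn n)*(sin (u (rn n)))^2*rn n^2 - (sin (u (rn n)))^3*cos (u (rn n)))) (0*L)).
{ eapply is_lim_seq_ext_loc; [|exact LR].
  assert (HB : eventually (fun n => 0 < (rn n * u1 (rn n))^2 + sin (u (rn n))^2)).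
  { apply (LK (fun y => 0 < y)). exists (mkposreal _ HS2). intros y Hy.
    assert (Hy' : Rabs (y - sin a^2) < sin a^2) by exact Hy. apply Rabs_def2 in Hy'. lra. }
  destruct HB as [n1 HB]. exists n1. intros n Hn. apply F_scaled. apply Hrn. now apply HB. }
pose proof (is_lim_seq_unique _ _ LB) as U1. rewrite (is_lim_seq_unique _ _ LR') in U1.
apply Rbar_finite_eq in U1.
assert (HP : 0 < Rpower (sin a^2) ((p-4)/2)) by apply exp_pos.
assert (HZ : Rpower (sin a^2) ((p-4)/2) * (sin a^2 * (sin a * cos a)) = 0) by (transitivity (-(0*L)); [rewrite U1; ring | ring]).
rewrite sin_2a.
apply Rmult_integral in HZ. destruct HZ as [HZ|HZ]; [lra|].
apply Rmult_integral in HZ. destruct HZ as [HZ|HZ]; lra.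
Qed.

Lemma continuous_on_rect_slice (T t : R) (f : R -> R -> R) : continuous_on_rect T f ->
  0 <= t <= T -> filterlim (f t) (at_right 0) (locally (f t 0)).
Proof.
intros Hf Ht P [eps HP].
destruct (continuous_on_rect_eps T f Hf t 0 Ht ltac:(lra) eps (cond_pos eps)) as [d [Hd HH]].
assert (Hm : 0 < Rmin d 1) by (apply Rmin_glb_lt; lra).
exists (mkposreal _ Hm). intros y Hy Hy0. apply HP. 
pose proof (Rmin_l d 1). pose proof (Rmin_r d 1).
assert (Hyy : Rabs (y - 0) < Rmin d 1) by exact Hy.
assert (y < 1) by (apply Rabs_def2 in Hyy; lra).
apply (HH t y); try lra. rewrite Rminus_diag, Rabs_R0; lra.
Qed.

(** Finiteness of the limit of [F] confines [h t 0] to the discrete set of multiples of [PI/2]; by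
    continuity in time it stays at its initial value. *)
Lemma solution_origin (p : R) (h0 : R -> R) (T : R) (h : R -> R -> R) : 1 < p -> 0 < T ->
  classical_solution p h0 T h -> h0 0 = 0 -> forall t, 0 <= t <= T -> h t 0 = 0.
Proof.
intros Hp HT (ht & hr & hrr & (_ & Ch & _ & Chr & Chrr) & _ & Hlim & Hi & _) H00.
assert (Hsin : forall t, 0 <= t <= T -> sin (2 * h t 0) = 0).
{ intros t Ht. apply (F_limit_sin2 p (h t) (hr t) (hrr t) _ (hr t 0) (hrr t 0) (ht t 0)); trivial.
  all: try (apply (continuous_on_rect_slice T t); trivial). now apply Hlim. }
pose proof PI2_1 as HPI.
(* [first_contact] is applied to a function independent of [r]. The level 1 lies strictly between 0
   and [PI/2], so [h t 0] cannot reach it in absolute value, and 0 is the only admissible value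
   below it. *)
assert (Hb : forall t r, 0 <= t <= T -> 0 <= r <= 1 -> 0 < 1 - h t 0 ^ 2).
{ apply (first_contact T (fun t _ => 1 - h t 0 ^2)); trivial.
  - intros [t r] [Ht Hr]. simpl in Ht, Hr. 
    assert (Hc : filterlim (fun z : R*R => h (fst z) 0) (within (rect T) (locally (t,r))) (locally (h t 0))).
    { intros P [eps HP]. destruct (continuous_on_rect_eps T h Ch t 0 Ht ltac:(lra) eps (cond_pos eps)) as [d [Hd HH]].
      exists (mkposreal d Hd). intros [s x] [Hs _] [Hs1 _]. apply HP. apply (HH s 0); trivial; try lra.
      rewrite Rminus_diag, Rabs_R0; lra. }
    apply (filterlim_comp _ _ _ (fun z : R*R => h (fst z) 0) (fun v => 1 - v^2) _ (locally (h t 0))); trivial.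
    apply (ex_derive_continuous (fun v => 1 - v^2)). auto_derive. trivial.
  - intros r Hr. rewrite Hi, H00 by lra. lra.
  - intros t r Ht Hr H0 _ _. specialize (Hsin t ltac:(lra)).
    assert (HH : h t 0 = 1 \/ h t 0 = -1).
    { assert ((h t 0 - 1)*(h t 0 + 1) = 0) by lra. apply Rmult_integral in H. lra. }
    assert (0 < sin 2) by (apply sin_gt_0; lra).
    destruct HH as [HH|HH]; rewrite HH in Hsin.
    + replace (2*1) with 2 in Hsin by ring. lra.
    + replace (2*-1) with (Ropp 2) in Hsin by ring. rewrite sin_neg in Hsin. lra. }
intros t Ht. specialize (Hb t 0 Ht ltac:(lra)). specialize (Hsin t Ht).
set (a := h t 0) in *. clearbody a.
assert (-1 < a < 1) by nra.
destruct (Rtotal_order a 0) as [Ha|[Ha|Ha]]; trivial; exfalso.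
- assert (0 < sin (2 * (-a))) by (apply sin_gt_0; lra).
  replace (2*(-a)) with (-(2*a)) in H0 by ring. rewrite sin_neg in H0. lra.
- assert (0 < sin (2 * a)) by (apply sin_gt_0; lra). lra.
Qed.


(* The solution of [lam' = - c lam^(1 - p)] with [lam(0)^p = mu0], extinct at
   time [mu0 / (p c)]. *)
Definition scale (p c mu0 t : R) := Rpower (mu0 - p*c*t) (/p).
Definition barrier (p c M d mu0 t r : R) := 2 * atan (profile M d (r / scale p c mu0 t)).

Lemma barrier_continuous (p c M d mu0 T : R) : 0 < p -> 0 < c -> p*c*T < mu0 ->
  continuous_on_rect T (barrier p c M d mu0).
Proof.
intros Hp Hc HT [t r] [Ht Hr]. simpl in Ht, Hr.
cut (continuous (fun z : R*R => barrier p c M d mu0 (fst z) (snd z)) (t,r)).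
{ intros HC P HP. destruct (HC P HP) as [eps H]. exists eps. intros z Hz _. now apply H. }
unfold barrier.
assert (Hmu : 0 < mu0 - p*c*t).
{ assert (p*c*t <= p*c*T) by (apply Rmult_le_compat_l; [apply Rmult_le_pos|]; lra). lra. }
assert (Hsc : 0 < scale p c mu0 t) by apply exp_pos.
apply (continuous_comp (fun z : R*R => snd z / scale p c mu0 (fst z)) (fun x => 2 * atan (profile M d x))).
- unfold Rdiv. apply (continuous_mult (K := R_AbsRing) (fun z : R*R => snd z) (fun z : R*R => / scale p c mu0 (fst z))).
  + apply continuous_snd.
  + apply (continuous_comp (fun z : R*R => fst z) (fun s => / scale p c mu0 s)).
    apply continuous_fst. simpl.
    apply (ex_derive_continuous (fun s => / scale p c mu0 s)).
    unfold scale, Rpower. auto_derive. split; [lra|]. split; trivial. apply Rgt_not_eq, exp_pos.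
- simpl. apply (ex_derive_continuous (fun x => 2 * atan (profile M d x))).
  unfold profile. auto_derive.
  assert (0 <= r / scale p c mu0 t) by (apply Rdiv_le_0_compat; lra). nra.
Qed.

Lemma continuous_on_rect_sub (T T' : R) (f : R -> R -> R) : T' <= T ->
  continuous_on_rect T f -> continuous_on_rect T' f.
Proof. 
intros HT Hf. apply (continuous_on_subset (rect T)); trivial.
intros [t r] [Ht Hr]. unfold rect in *; simpl in *. lra.
Qed.

Lemma continuous_on_rect_minus (T : R) (f g : R -> R -> R) : 
  continuous_on_rect T f -> continuous_on_rect T g -> continuous_on_rect T (fun t r => f t r - g t r).
Proof.
intros Hf Hg z Hz. specialize (Hf z Hz). specialize (Hg z Hz).
assert (Hg' := filterlim_comp _ _ _ _ _ _ _ _ Hg (filterlim_opp (V := R_NormedModule) (g (fst z) (snd z)))).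
exact (filterlim_comp_2 _ _ _ Hf Hg' (filterlim_plus (V := R_NormedModule) (f (fst z) (snd z)) (opp (g (fst z) (snd z))))).
Qed.

Lemma profile_at_0_neg (M d : R) : 0 < M -> 0 < d -> 2 * atan (profile M d 0) < 0.
Proof.
intros HM Hd. unfold profile. replace (M*(0-d)/(1+0)^2) with (-(M*d)) by field.
rewrite atan_opp.
assert (0 < atan (M*d)) by (rewrite <- atan_0; apply atan_increasing; now apply Rmult_lt_0_compat). lra.
Qed.

Lemma barrier_below (p c M d mu0 T T' : R) (h0 : R -> R) (h : R -> R -> R) :
  1 < p < 2 -> 0 < c -> 0 < M -> 0 < d -> (forall rho, 0 < rho -> strict_profile p c M d rho) ->
  0 < T' <= T -> p*c*T' < mu0 ->
  classical_solution p h0 T h -> h0 0 = 0 ->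
  (forall r, 0 <= r <= 1 -> barrier p c M d mu0 0 r < h0 r) ->
  (forall t, 0 <= t <= T' -> barrier p c M d mu0 t 1 < h0 1) ->
  forall t r, 0 <= t <= T' -> 0 <= r <= 1 -> barrier p c M d mu0 t r < h t r.
Proof.
intros Hp Hc HM Hd Hcore HT Hmu Hsol H00 Hinit Hbd t r Ht Hr.
assert (Horig := solution_origin p h0 T h ltac:(lra) ltac:(lra) Hsol H00).
destruct Hsol as (ht & hr & hrr & (Hder & Ch & _) & Heq & _ & Hi & Hb).
apply Rlt_0_minus. revert t r Ht Hr.
apply (first_contact T' (fun t r => h t r - barrier p c M d mu0 t r)); [lra| | |].
{ apply continuous_on_rect_minus. apply (continuous_on_rect_sub T); trivial; lra.
  apply barrier_continuous; lra. }
{ intros r Hr. rewrite Hi by trivial. specialize (Hinit r Hr). lra. }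
intros t r Ht Hr H0 Hmin Hbefore.
assert (Hmut : 0 < mu0 - p*c*t).
{ assert (p*c*t <= p*c*T') by (apply Rmult_le_compat_l; [apply Rmult_le_pos|]; lra). lra. }
destruct (Req_dec r 0) as [->|Hr0].
{ rewrite Horig in H0 by lra. unfold barrier in H0.
  replace (0 / scale p c mu0 t) with 0 in H0 by (unfold Rdiv; ring).
  pose proof (profile_at_0_neg M d HM Hd). lra. }
destruct (Req_dec r 1) as [->|Hr1].
{ specialize (Hbd t ltac:(lra)). rewrite Hb in H0 by lra. lra. }
set (lam := scale p c mu0 t) in *.
assert (Hlam : 0 < lam) by apply exp_pos.
set (rho := r/lam).
assert (Hx : hr t r - speed M d rho / r = 0 /\ 0 <= hrr t r - (accel M d rho - speed M d rho)/r^2).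
{ apply (interior_min 0 1 (fun x => h t x - barrier p c M d mu0 t x) (fun x => hr t x - speed M d (x/lam)/x) r); [lra| | |].
  - intros y Hy. apply (is_derive_minus (h t) (barrier p c M d mu0 t)).
    + apply (is_derive_in_is_derive 0 1); [lra|]. apply Hder; lra.
    + apply (barrier_derive_r M d lam y); lra.
  - apply (is_derive_minus (hr t) (fun x => speed M d (x/lam)/x)).
    + apply (is_derive_in_is_derive 0 1); [lra|]. apply Hder; lra.
    + apply (barrier_derive_rr M d lam r); lra.
  - intros y Hy. rewrite H0. now apply Hmin. }
destruct Hx as [Hx1 Hx2].
assert (Htime : ht t r - speed M d rho * c / (mu0 - p*c*t) <= 0).
{ apply (is_derive_in_nonpos_left 0 T (fun s => h s r - barrier p c M d mu0 s r) t); [lra| |].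
  - apply is_derive_in_minus. apply Hder; lra. apply is_derive_is_derive_in.
    apply (barrier_derive_t M d r p c mu0 t); lra.
  - intros s Hs. rewrite H0. left. now apply Hbefore. }
(* With [f] the barrier, [h] and [h_r] agree with [f] and [f_r] at the contact point, and the
   contradiction is [h_t <= f_t < F(f) <= F(h) = h_t]. *)
pose proof (profile_subsolution p c M d (mu0-p*c*t) r ltac:(lra) Hmut ltac:(lra) HM Hd) as Hsub.
fold (scale p c mu0 t) in Hsub. fold lam in Hsub. cbv zeta in Hsub. fold rho in Hsub.
specialize (Hsub (Hcore rho ltac:(apply Rdiv_lt_0_compat; lra))).
destruct (Heq t r ltac:(lra) ltac:(lra)) as [_ HF].
assert (Eh : h t r = 2 * atan (profile M d rho)) by (unfold barrier in H0; fold lam rho in H0; lra).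
rewrite Eh in HF. replace (hr t r) with (speed M d rho / r) in HF by lra.
pose proof (F_mono p r (2 * atan (profile M d rho)) (speed M d rho / r)
  ((accel M d rho - speed M d rho)/r^2) (hrr t r) ltac:(lra) ltac:(lra)).
lra.
Qed.

Lemma blowup (p c M d mu0 T : R) (h0 : R -> R) (h : R -> R -> R) :
  1 < p < 2 -> 0 < c -> 5000 <= M -> 0 < d <= 1/10 -> (forall rho, 0 < rho -> strict_profile p c M d rho) ->
  0 < mu0 -> classical_solution p h0 T h -> h0 0 = 0 ->
  (forall r, 0 <= r <= 1 -> barrier p c M d mu0 0 r < h0 r) ->
  (forall t, 0 <= t < mu0/(p*c) -> barrier p c M d mu0 t 1 < h0 1) ->
  T < mu0/(p*c).
Proof.
intros Hp Hc HM Hd Hcore Hmu Hsol H00 Hinit Hbd.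
apply Rnot_le_lt. intros HT.
assert (Hpc : 0 < p*c) by (apply Rmult_lt_0_compat; lra).
set (Ts := mu0/(p*c)) in *.
assert (HTs : 0 < Ts) by (apply Rdiv_lt_0_compat; lra).
assert (ETs : p*c*Ts = mu0) by (unfold Ts; field; lra).
assert (Horig := solution_origin p h0 T h ltac:(lra) ltac:(lra) Hsol H00 Ts ltac:(lra)).
assert (Ch : continuous_on_rect T h) by (destruct Hsol as (ht & hr & hrr & (_ & Ch & _) & _); exact Ch).
destruct (continuous_on_rect_eps T h Ch Ts 0 ltac:(lra) ltac:(lra) 1 Rlt_0_1) as [delta [Hdelta HH]].
(* The point [(t, x)] with [lam(t) = x] must lie within [delta] of [(Ts, 0)]. As
   [Ts - t = x^p/(p*c)] and [x^p <= x], bounds on [x] suffice; [mu0/2] ensures [t > 0]. *)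
set (x := Rmin (Rmin (1/2) (delta/2)) (Rmin (mu0/2) (delta*(p*c)/2))).
assert (Hx : 0 < x /\ x <= 1/2 /\ x <= delta/2 /\ x <= mu0/2 /\ x <= delta*(p*c)/2).
{ unfold x. pose proof (Rmin_l (Rmin (1/2) (delta/2)) (Rmin (mu0/2) (delta*(p*c)/2))).
  pose proof (Rmin_r (Rmin (1/2) (delta/2)) (Rmin (mu0/2) (delta*(p*c)/2))).
  pose proof (Rmin_l (1/2) (delta/2)). pose proof (Rmin_r (1/2) (delta/2)).
  pose proof (Rmin_l (mu0/2) (delta*(p*c)/2)). pose proof (Rmin_r (mu0/2) (delta*(p*c)/2)).
  assert (0 < delta*(p*c)) by (apply Rmult_lt_0_compat; lra).
  repeat split; try lra. repeat apply Rmin_glb_lt; lra. }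
clearbody x. destruct Hx as (Hx0 & Hx1 & Hx2 & Hx3 & Hx4).
pose proof (Rpower_le_id x p ltac:(lra) ltac:(lra)) as Hm.
set (t := Ts - Rpower x p / (p*c)).
assert (Em : mu0 - p*c*t = Rpower x p) by (unfold t; rewrite <- ETs; field; lra).
assert (Hq : 0 < Rpower x p/(p*c) <= delta/2).
{ split. apply Rdiv_lt_0_compat; lra. apply (Rmult_le_reg_r (p*c)); trivial. 
  replace (Rpower x p / (p * c) * (p * c)) with (Rpower x p) by (field; lra). lra. }
assert (Ht0 : 0 < t).
{ apply (Rmult_lt_reg_l (p*c)); lra. }
assert (Ht : 0 < t < Ts) by (unfold t in *; lra).
assert (Es : scale p c mu0 t = x).
{ unfold scale. rewrite Em, Rpower_mult, Rinv_r, Rpower_1 by lra. reflexivity. }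
assert (Hb : barrier p c M d mu0 t x < h t x).
{ apply (barrier_below p c M d mu0 T t h0 h); trivial; try lra. intros s Hs. apply Hbd. lra. }
specialize (HH t x ltac:(lra) ltac:(lra)). rewrite Horig in HH.
assert (Habs : Rabs (h t x - 0) < 1).
{ apply HH. rewrite Rabs_left by lra. unfold t. lra. rewrite Rminus_0_r, Rabs_right; lra. }
apply Rabs_def2 in Habs.
unfold barrier in Hb. rewrite Es in Hb. replace (x/x) with 1 in Hb by (field; lra).
assert (1 < profile M d 1).
{ unfold profile. apply (Rmult_lt_reg_r ((1+1)^2)); [lra|]. unfold Rdiv; rewrite Rmult_assoc, Rinv_l by lra. nra. }
apply atan_increasing in H. rewrite atan_1 in H. pose proof PI2_1. lra.
Qed.


(** * The initial datum *)

(** Concavity through two mean values: a point below the chord would give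
    [PI * cos c1 < 2 < PI * cos c2] with [c1 < c2], against the decrease of the cosine. *)
Lemma sin_ge_chord (x : R) : 0 <= x <= PI/2 -> 2*x <= PI * sin x.
Proof.
intros Hx. pose proof PI2_1 as HPI.
destruct (Req_dec x 0) as [->|H0]; [rewrite sin_0; lra|].
destruct (Req_dec x (PI/2)) as [->|H1]; [rewrite sin_PI2; lra|].
apply Rnot_lt_le. intros Hlt.
set (G := fun y => PI * sin y - 2*y).
assert (HG : forall c, derivable_pt_lim G c (PI * cos c - 2)).
{ intros c. apply is_derive_Reals. unfold G. auto_derive; [trivial|ring]. }
destruct (MVT_cor2 G (fun c => PI * cos c - 2) 0 x) as [c1 [E1 Hc1]]; [lra | intros; apply HG |].
destruct (MVT_cor2 G (fun c => PI * cos c - 2) x (PI/2)) as [c2 [E2 Hc2]]; [lra | intros; apply HG |].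
unfold G in E1, E2. rewrite sin_0 in E1. rewrite sin_PI2 in E2.
assert (Hcos : cos c2 < cos c1) by (apply cos_decreasing_1; lra).
assert (PI * cos c2 < PI * cos c1) by (apply Rmult_lt_compat_l; lra).
assert (PI * cos c1 - 2 < 0) by nra. assert (0 < PI * cos c2 - 2) by nra. lra.
Qed.

Lemma atan_nonpos (t : R) : t <= 0 -> atan t <= 0.
Proof.
intros H. rewrite <- atan_0. destruct (Rle_lt_or_eq_dec _ _ H) as [H1| ->]; [|lra].
left; now apply atan_increasing.
Qed.

(** For [t > 0] the chord bound gives [2 atan t <= PI sin (atan t) = PI t / sqrt (1+t^2)]. This has
    the algebraic shape of the datum, and comparing squares leaves just [t^2*e < r^2]; the datum is
    given its form for this purpose. *)
Lemma double_atan_lt (t r e : R) : 0 < r -> 0 < e -> t^2*e < r^2 -> 2 * atan t < PI * r / sqrt (r^2+e).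
Proof.
intros Hr He Ht. pose proof PI2_1 as HPI.
assert (HQ : 0 < sqrt (r^2+e)) by (apply sqrt_lt_R0; nra).
assert (HR : 0 < PI * r / sqrt (r^2+e)) by (apply Rdiv_lt_0_compat; nra).
destruct (Rle_dec t 0) as [Ht0|Ht0].
{ pose proof (atan_nonpos t Ht0). lra. }
assert (Ha : 0 < atan t) by (rewrite <- atan_0; apply atan_increasing; lra).
pose proof (atan_bound t) as Hb.
eapply Rle_lt_trans; [apply sin_ge_chord; lra|].
rewrite sin_atan, Rsqr_pow2. unfold Rdiv. rewrite (Rmult_assoc PI r). apply Rmult_lt_compat_l; [lra|].
pose proof (one_plus_sq t) as HW.
assert (HS : 0 < sqrt (1+t^2)) by (now apply sqrt_lt_R0).
apply (Rmult_lt_reg_r (sqrt (1+t^2) * sqrt (r^2+e))); [now apply Rmult_lt_0_compat|].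
replace (t * / sqrt (1 + t ^ 2) * (sqrt (1 + t ^ 2) * sqrt (r ^ 2 + e))) with (t * sqrt (r^2+e)) by (field; lra).
replace (r * / sqrt (r ^ 2 + e) * (sqrt (1 + t ^ 2) * sqrt (r ^ 2 + e))) with (r * sqrt (1+t^2)) by (field; lra).
apply Rsqr_incrst_0; [| apply Rmult_le_pos; lra | apply Rmult_le_pos; lra].
rewrite !Rsqr_mult, !Rsqr_sqrt by nra. unfold Rsqr. nra.
Qed.

Lemma profile_le (M d lam r : R) : 0 < M -> 0 < d -> 0 < lam -> 0 < r ->
  profile M d (r/lam) <= M/lam*r /\ profile M d (r/lam) <= M*lam/r.
Proof.
intros HM Hd Hl Hr. set (rho := r/lam).
assert (Hrho : 0 < rho) by (apply Rdiv_lt_0_compat; lra).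
assert (HP : 0 < (1+rho)^2) by (apply pow_lt; lra).
replace (M/lam*r) with (M*rho) by (unfold rho; field; lra).
replace (M*lam/r) with (M/rho) by (unfold rho; field; lra).
unfold profile. split; apply (Rmult_le_reg_r ((1+rho)^2)); trivial; unfold Rdiv;
 rewrite (Rmult_assoc _ (/ (1+rho)^2)), Rinv_l, Rmult_1_r by lra.
- rewrite Rmult_assoc. apply Rmult_le_compat_l; [lra|]. nra.
- rewrite Rmult_assoc. apply Rmult_le_compat_l; [lra|].
  apply (Rmult_le_reg_l rho); trivial. rewrite <- Rmult_assoc, Rinv_r by lra. nra.
Qed.

Lemma is_C2_of_is_derive (f f1 f2 : R -> R) : (forall x, is_derive f x (f1 x)) ->
  (forall x, is_derive f1 x (f2 x)) -> (forall x, continuous f2 x) -> is_C2 f f1 f2.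
Proof.
intros H1 H2 H3. split.
- intros x _. split; now apply is_derive_is_derive_in.
- intros x _ P HP. destruct (H3 x P HP) as [eps H]. exists eps. intros y Hy _. now apply H.
Qed.

Section Datum.
Context (k b B : R).
Context (Hk : 0 < k).

(* The coefficient 1/2 gives [h_r(1) = 0]; the choice of [k] will give [h(1) = l]
   and that of [b] will give [h_rr(1) = sin l cos l], hence [F(h_0) = 0] at
   [r = 1]; a large [B] lifts the datum close to [PI] away from the boundary. *)
Definition expo (r : R) := (1-r^2)/2 + b*(1-r^2)^2 + B*(1-r^2)^3.
Definition expo1 (r : R) := -2*r*(1/2 + 2*b*(1-r^2) + 3*B*(1-r^2)^2).
Definition expo2 (r : R) := -2*(1/2 + 2*b*(1-r^2) + 3*B*(1-r^2)^2) + 4*r^2*(2*b + 6*B*(1-r^2)).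
(** The datum is [PI r / sqrt (r^2 + bump r)]. The exponential keeps [bump] positive, hence the
    datum below [PI], for all [b] and [B]. *)
Definition bump (r : R) := k * exp (-2 * expo r).
Definition quad (r : R) := r^2 + bump r.
Definition quad1 (r : R) := 2*r - 2 * expo1 r * bump r.
Definition quad2 (r : R) := 2 + (4 * expo1 r ^2 - 2 * expo2 r) * bump r.

Lemma quad_pos (r : R) : 0 < bump r /\ 0 < quad r.
Proof.
assert (0 < bump r) by (apply Rmult_lt_0_compat; [trivial | apply exp_pos]).
unfold quad. pose proof (pow2_ge_0 r). lra.
Qed.

Lemma expo_derive (r : R) : is_derive expo r (expo1 r).
Proof. unfold expo, expo1. auto_derive; [trivial|]. field. Qed.

Lemma expo1_derive (r : R) : is_derive expo1 r (expo2 r).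
Proof. unfold expo1, expo2. auto_derive; [trivial|]. field. Qed.

Lemma bump_derive (r : R) : is_derive bump r (-2 * expo1 r * bump r).
Proof.
unfold bump. evar_last. auto_derive. exists (expo1 r); apply expo_derive.
replace (Derive (fun x => expo x) r) with (expo1 r) by (symmetry; apply is_derive_unique, expo_derive).
reflexivity. ring.
Qed.

Lemma quad_derive (r : R) : is_derive quad r (quad1 r).
Proof.
unfold quad, quad1. evar_last. auto_derive. exists (-2 * expo1 r * bump r); apply bump_derive.
replace (Derive (fun x => bump x) r) with (-2 * expo1 r * bump r) by (symmetry; apply is_derive_unique, bump_derive).
reflexivity. ring.
Qed.

Lemma quad1_derive (r : R) : is_derive quad1 r (quad2 r).
Proof.
unfold quad1, quad2. evar_last. auto_derive.
repeat split. exists (expo2 r); apply expo1_derive. exists (-2 * expo1 r * bump r); apply bump_derive.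
replace (Derive (fun x => expo1 x) r) with (expo2 r) by (symmetry; apply is_derive_unique, expo1_derive).
replace (Derive (fun x => bump x) r) with (-2 * expo1 r * bump r) by (symmetry; apply is_derive_unique, bump_derive).
reflexivity. ring.
Qed.

Lemma quad2_ex_derive (r : R) : ex_derive quad2 r.
Proof. unfold quad2, bump, expo2, expo1, expo. auto_derive. trivial. Qed.

Definition slope (r : R) := PI / sqrt (quad r).
Definition slope1 (r : R) := - (PI/2) * quad1 r / (quad r * sqrt (quad r)).
Definition slope2 (r : R) := PI * (3/4 * quad1 r^2 / (quad r^2 * sqrt (quad r)) - 1/2 * quad2 r / (quad r * sqrt (quad r))).

Ltac quad_facts r :=
  pose proof (proj2 (quad_pos r)) as HQ;
  pose proof (sqrt_lt_R0 _ HQ) as HS; 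
  pose proof (sqrt_sqrt (quad r) ltac:(lra)) as HSS.

Lemma slope_derive (r : R) : is_derive slope r (slope1 r).
Proof.
quad_facts r. unfold slope.
evar_last. auto_derive. split; [exists (quad1 r); apply quad_derive | split; lra].
replace (Derive (fun x => quad x) r) with (quad1 r) by (symmetry; apply is_derive_unique, quad_derive).
reflexivity.
unfold slope1. set (s := sqrt (quad r)) in *. rewrite <- HSS. field. lra.
Qed.

Lemma slope1_derive (r : R) : is_derive slope1 r (slope2 r).
Proof.
quad_facts r. unfold slope1.
evar_last. auto_derive. 
repeat split; first [exists (quad1 r); apply quad_derive | exists (quad2 r); apply quad1_derive | apply Rgt_not_eq, Rmult_lt_0_compat; lra | lra].
replace (Derive (fun x => quad x) r) with (quad1 r) by (symmetry; apply is_derive_unique, quad_derive).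
replace (Derive (fun x => quad1 x) r) with (quad2 r) by (symmetry; apply is_derive_unique, quad1_derive).
reflexivity.
unfold slope2. set (s := sqrt (quad r)) in *. rewrite <- HSS. field. lra.
Qed.

Lemma slope2_ex_derive (r : R) : ex_derive slope2 r.
Proof.
quad_facts r. unfold slope2. auto_derive.
repeat split; first [exists (quad1 r); apply quad_derive | exists (quad2 r); apply quad1_derive | apply quad2_ex_derive 
 | repeat apply Rmult_integral_contrapositive_currified; lra | lra].
Qed.

Lemma slope_C2 : is_C2 slope slope1 slope2.
Proof.
apply is_C2_of_is_derive. apply slope_derive. apply slope1_derive.
intros x. apply (ex_derive_continuous slope2), slope2_ex_derive.
Qed.

Definition datum (r : R) := r * slope r.
Definition datum1 (r : R) := slope r + r * slope1 r.
Definition datum2 (r : R) := 2 * slope1 r + r * slope2 r.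

Lemma datum_C2 : is_C2 datum datum1 datum2.
Proof.
apply is_C2_of_is_derive.
- intros x. unfold datum, datum1. evar_last.
  apply (is_derive_mult (fun y => y) slope). apply @is_derive_id. apply slope_derive. intros; apply Rmult_comm.
  unfold plus, mult, one; simpl. ring.
- intros x. unfold datum1, datum2. evar_last.
  apply (is_derive_plus slope (fun y => y * slope1 y)). apply slope_derive.
  apply (is_derive_mult (fun y => y) slope1). apply @is_derive_id. apply slope1_derive. intros; apply Rmult_comm.
  unfold plus, mult, one; simpl. ring.
- intros x. apply (ex_derive_continuous datum2). unfold datum2. auto_derive.
  repeat split. exists (slope2 x). apply slope1_derive. apply slope2_ex_derive.
Qed.

(** [B] drops out since its term vanishes to third order at 1: it remains free once the conditions
    at the boundary are met. *)
Lemma expo_at_1 : expo 1 = 0 /\ expo1 1 = -1 /\ expo2 1 = 8*b-1.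
Proof. unfold expo, expo1, expo2. repeat split; field. Qed.

Lemma datum_range (r : R) : 0 < r <= 1 -> 0 < datum r < PI.
Proof.
intros Hr. quad_facts r. unfold datum, slope. pose proof PI2_1 as HPI.
assert (HrS : r < sqrt (quad r)).
{ apply Rsqr_incrst_0; try lra. rewrite Rsqr_sqrt by lra. unfold quad, Rsqr. pose proof (proj1 (quad_pos r)). lra. }
split. apply Rmult_lt_0_compat; [lra|]. apply Rdiv_lt_0_compat; lra.
apply (Rmult_lt_reg_r (sqrt (quad r))); trivial. unfold Rdiv. rewrite !Rmult_assoc, Rinv_l by lra. nra.
Qed.

Lemma datum_at_1 (l : R) : 0 < l < PI -> k = PI^2/l^2 - 1 ->
  b = (4*k + 2*(1+k)*(sin l*cos l/l))/(16*k) ->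
  datum 1 = l /\ datum1 1 = 0 /\ datum2 1 = sin l * cos l.
Proof.
intros Hl Ek Eb. destruct expo_at_1 as (E0 & E1 & E2).
assert (EB : bump 1 = k). { unfold bump. rewrite E0, Rmult_0_r, exp_0. ring. }
assert (EQ : quad 1 = 1+k). { unfold quad. rewrite EB. ring. }
assert (EQ1 : quad1 1 = 2*(1+k)). { unfold quad1. rewrite EB, E1. ring. }
assert (EQ2 : quad2 1 = 2*(1+k)*(1 - sin l*cos l/l)). { unfold quad2. rewrite EB, E1, E2, Eb. field. lra. }
assert (ES : sqrt (1+k) = PI/l).
{ rewrite Ek. replace (1+(PI^2/l^2-1)) with ((PI/l)^2) by (field; lra). apply sqrt_pow2.
  left. apply Rdiv_lt_0_compat; lra. }
assert (EK : 1+k = (PI/l)*(PI/l)) by (rewrite Ek; field; lra).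
unfold datum2, datum1, datum, slope2, slope1, slope. rewrite EQ, EQ1, EQ2, ES, EK.
repeat split; field; lra.
Qed.

Lemma datum_admissible (p l : R) : 0 < l < PI -> k = PI^2/l^2 - 1 ->
  b = (4*k + 2*(1+k)*(sin l*cos l/l))/(16*k) -> admissible p l datum.
Proof.
intros Hl Ek Eb. destruct (datum_at_1 l Hl Ek Eb) as (D0 & D1 & D2).
pose proof PI2_1 as HPI.
split; [|split; [|split; [|split]]].
- exists datum1, datum2. split; [exact datum_C2|]. split; [|split].
  + quad_facts 0. unfold datum1, slope. rewrite Rmult_0_l, Rplus_0_r. apply Rdiv_lt_0_compat; lra.
  + unfold datum2, slope1, quad1, expo1. unfold Rdiv. ring.
  + rewrite D0, D1, D2. unfold F, A. unfold Rdiv. rewrite !pow1, Rinv_1. ring.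
- unfold datum. ring.
- exact datum_range.
- exact D0.
- exists slope, slope1, slope2. split; [exact slope_C2|]. intros r Hr. unfold datum. field. lra.
Qed.

(** For [r^2 <= 1/2], the bound [(M/lam)*r] on the profile reduces the claim to
    [(M/lam)^2 * bump r < 1], which follows from [exp x >= 1 + x] because [B] makes [expo] large.
    For [r^2 > 1/2], the bounds [M*lam/r] on the profile and [k] on [bump] reduce it to
    [k*(M*lam)^2 < r^4], where [r^4 > 1/4]. *)
Lemma datum_above (M d lam r : R) : 0 < M -> 0 < d -> 0 < lam -> 4*k*(M*lam)^2 < 1 ->
  b^2 + 8*Rabs b + 8*(k*(M/lam)^2) <= B -> 0 < r <= 1 ->
  2 * atan (profile M d (r/lam)) < datum r.
Proof.
intros HM Hd Hlam Hsmall HB Hr.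
destruct (quad_pos r) as [Hbp _].
replace (datum r) with (PI * r / sqrt (r^2 + bump r)) by (unfold datum, slope, quad, Rdiv; ring).
destruct (Rle_dec (profile M d (r/lam)) 0) as [Ht|Ht].
{ pose proof (atan_nonpos _ Ht). pose proof PI2_1. assert (0 < PI * r / sqrt (r ^ 2 + bump r)); [|lra].
  apply Rdiv_lt_0_compat; [nra|]. apply sqrt_lt_R0. apply quad_pos. }
apply double_atan_lt; [lra | trivial |].
destruct (profile_le M d lam r HM Hd Hlam (proj1 Hr)) as [T1 T2].
set (t := profile M d (r/lam)) in *. clearbody t.
set (y := 1 - r^2).
assert (Hy : 0 <= y <= 1) by (unfold y; nra).
assert (Habs : - Rabs b <= b <= Rabs b) by (pose proof (Rle_abs b); pose proof (Rle_abs (-b)) as Hn; rewrite Rabs_Ropp in Hn; lra).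
assert (Hab0 : 0 <= Rabs b) by apply Rabs_pos.
assert (HkM : 0 <= k*(M/lam)^2) by (apply Rmult_le_pos; [lra | apply pow2_ge_0]).
assert (Hexp : expo r = y*(1/2 + b*y + B*y^2)) by (unfold expo, y; field).
assert (HBb : b^2 <= B) by lra.
destruct (Rle_dec (r^2) (1/2)) as [Hr2|Hr2].
- assert (Hy2 : 1/2 <= y) by (unfold y; lra).
  assert (Hw : k*(M/lam)^2 <= 2*expo r).
  { rewrite Hexp. set (K := k*(M/lam)^2) in *. clearbody K.
    pose proof (pow2_ge_0 b) as Hbb. assert (HB0 : 0 <= B) by lra.
    assert (Hyy : 1/4 <= y^2) by (clear - Hy2; nra).
    assert (B*(1/4) <= B*y^2) by (apply Rmult_le_compat_l; lra).
    assert (- Rabs b <= b*y) by (clear - Habs Hab0 Hy; nra).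
    assert (HKy : 2*K <= 1/2 + b*y + B*y^2) by lra.
    assert (1/2*(2*K) <= y*(1/2 + b*y + B*y^2)) by (apply Rmult_le_compat; lra). lra. }
  assert (Hb2 : bump r * (1 + 2*expo r) <= k).
  { unfold bump. rewrite Rmult_assoc. rewrite <- (Rmult_1_r k) at 2. apply Rmult_le_compat_l; [lra|].
    pose proof (exp_ineq1_le (2*expo r)) as HE.
    apply Rle_trans with (exp (-2*expo r) * exp (2*expo r)).
    apply Rmult_le_compat_l; [left; apply exp_pos | trivial].
    rewrite <- exp_plus. replace (-2*expo r + 2*expo r) with 0 by ring. rewrite exp_0; lra. }
  assert (Hlt : (M/lam)^2 * bump r < 1).
  { assert (HMl : 0 < (M/lam)^2) by (apply pow_lt, Rdiv_lt_0_compat; lra).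
    apply (Rmult_lt_reg_l k); trivial. 
    assert (bump r * (k*(M/lam)^2) <= bump r * (2*expo r)) by (apply Rmult_le_compat_l; lra). lra. }
  assert (t^2 <= (M/lam*r)^2) by (apply pow_incr; lra).
  assert (t^2 * bump r <= (M/lam*r)^2 * bump r) by (apply Rmult_le_compat_r; lra).
  assert ((M/lam*r)^2 * bump r = r^2 * ((M/lam)^2*bump r)) by ring.
  assert (0 < r^2) by (apply pow_lt; lra).
  assert (r^2 * ((M/lam)^2*bump r) < r^2*1) by (apply Rmult_lt_compat_l; lra). lra.
(* [B >= b^2], and [b^2*y^2 + b*y + 1/2] is positive by completing the square. *)
- assert (Hw : 0 <= expo r).
  { rewrite Hexp. apply Rmult_le_pos; [lra|]. 
    assert ((b*y)^2 <= B*y^2) by (rewrite Rpow_mult_distr; apply Rmult_le_compat_r; [apply pow2_ge_0|lra]).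
    pose proof (pow2_ge_0 (b*y + 1/2)). lra. }
  assert (Hbk : bump r <= k).
  { unfold bump. rewrite <- (Rmult_1_r k) at 2. apply Rmult_le_compat_l; [lra|].
    destruct (Rle_lt_or_eq_dec _ _ Hw) as [H|H]. rewrite <- exp_0. left. apply exp_increasing. lra.
    rewrite <- H, Rmult_0_r, exp_0. lra. }
  assert (t*r <= M*lam).
  { apply Rmult_le_compat_r with (r := r) in T2; [|lra]. replace (M*lam/r*r) with (M*lam) in T2 by (field; lra). trivial. }
  assert (Htr : (t*r)^2 <= (M*lam)^2) by (apply pow_incr; split; [apply Rmult_le_pos; lra | trivial]).
  assert (Hr0 : 0 < r^2) by lra.
  apply (Rmult_lt_reg_r (r^2)); trivial.
  replace (t^2*bump r*r^2) with ((t*r)^2*bump r) by ring.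
  apply Rle_lt_trans with ((M*lam)^2*k).
  apply Rmult_le_compat; try lra. apply pow2_ge_0. nra.
Qed.
End Datum.


Lemma datum_above_boundary (k b B M d lam : R) : 0 < k -> 0 < M -> 0 < d -> 0 < lam ->
  4*k*(M*lam)^2 < 1 -> 2 * atan (profile M d (1/lam)) < datum k b B 1.
Proof.
intros Hk HM Hd Hlam Hsmall.
assert (EB : bump k b B 1 = k).
{ unfold bump. rewrite (proj1 (expo_at_1 b B)), Rmult_0_r, exp_0. ring. }
replace (datum k b B 1) with (PI * 1 / sqrt (1^2 + k)) by (unfold datum, slope, quad, Rdiv; rewrite EB; ring).
destruct (Rle_dec (profile M d (1/lam)) 0) as [Ht|Ht].
{ pose proof (atan_nonpos _ Ht). pose proof PI2_1. assert (0 < PI * 1 / sqrt (1 ^ 2 + k)); [|lra].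
  apply Rdiv_lt_0_compat; [lra|]. apply sqrt_lt_R0. lra. }
apply double_atan_lt; [lra | trivial |].
destruct (profile_le M d lam 1 HM Hd Hlam Rlt_0_1) as [_ T2]. rewrite Rdiv_1_r in T2.
assert (profile M d (1/lam)^2 <= (M*lam)^2) by (apply pow_incr; lra).
assert (profile M d (1/lam)^2*k <= (M*lam)^2*k) by (apply Rmult_le_compat_r; lra). lra.
Qed.

Theorem theorem1p8 (p : R) (hp : 1 < p < 2) (l : R) (hl : 0 < l < PI) :
  exists h0 : R -> R,
    admissible p l h0 /\ Rbar_lt (maximal_existence_time p h0) p_infty.
Proof.
destruct (strict_profile_exists p hp) as (c & M & d & Hc & HM & Hd & Hcore).
set (k := PI^2/l^2 - 1).
assert (Hk : 0 < k).
{ unfold k. assert (1 < PI/l) by (apply (Rmult_lt_reg_r l); [lra | field_simplify; lra]).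
  replace (PI^2/l^2) with ((PI/l)^2) by (field; lra). nra. }
set (b := (4*k + 2*(1+k)*(sin l*cos l/l))/(16*k)).
(* Makes [4*k*(M*lam0)^2] equal to [k/(1+k)^2], which is less than 1. *)
set (lam0 := /(2*M*(1+k))).
assert (HMk : 0 < 2*M*(1+k)) by (repeat apply Rmult_lt_0_compat; lra).
assert (Hlam0 : 0 < lam0) by (now apply Rinv_0_lt_compat).
assert (Hsmall : 4*k*(M*lam0)^2 < 1).
{ replace (M*lam0) with (/(2*(1+k))) by (unfold lam0; field; lra).
  apply (Rmult_lt_reg_r ((2*(1+k))^2)); [apply pow_lt; lra|]. field_simplify; [nra | lra]. }
set (B := b^2 + 8*Rabs b + 8*(k*(M/lam0)^2)).
set (mu0 := Rpower lam0 p).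
assert (Hmu0 : 0 < mu0) by apply exp_pos.
assert (Hpc : 0 < p*c) by (apply Rmult_lt_0_compat; lra).
assert (Hscale : forall t, 0 <= t < mu0/(p*c) -> scale p c mu0 t <= lam0).
{ intros t Ht. replace lam0 with (Rpower mu0 (/p)).
  2: { unfold mu0. rewrite Rpower_mult, Rinv_r, Rpower_1 by lra. reflexivity. }
  apply Rle_Rpower_l. left; apply Rinv_0_lt_compat; lra.
  assert (p*c*t < p*c*(mu0/(p*c))) by (apply Rmult_lt_compat_l; lra).
  replace (p*c*(mu0/(p*c))) with mu0 in H by (field; lra).
  assert (0 <= p*c*t) by (apply Rmult_le_pos; lra). lra. }
assert (Hscale0 : scale p c mu0 0 = lam0).
{ unfold scale, mu0. rewrite Rmult_0_r, Rminus_0_r, Rpower_mult, Rinv_r, Rpower_1 by lra. reflexivity. }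
exists (datum k b B). split.
{ now apply datum_admissible. }
(* The extinction time of the barrier bounds every time up to which a classical solution exists,
   hence their supremum. *)
apply Rbar_le_lt_trans with (Finite (mu0/(p*c))); [|exact I].
apply (proj2 (Lub_Rbar_correct _)). intros T [_ [h Hsol]]. left.
apply (blowup p c M d mu0 T (datum k b B) h); trivial.
- unfold datum. ring.
- intros r Hr. unfold barrier. rewrite Hscale0.
  destruct (Req_dec r 0) as [->|Hr0].
  + replace (0/lam0) with 0 by (unfold Rdiv; ring). unfold datum. rewrite Rmult_0_l. apply profile_at_0_neg; lra.
  + apply datum_above; try lra. unfold B; lra.
- intros t Ht. unfold barrier. specialize (Hscale t Ht).
  assert (Hs : 0 < scale p c mu0 t) by apply exp_pos.
  apply datum_above_boundary; try lra.
  assert ((M*scale p c mu0 t)^2 <= (M*lam0)^2).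
  { apply pow_incr. split. apply Rmult_le_pos; lra. apply Rmult_le_compat_l; lra. }
  assert (4*k*(M * scale p c mu0 t)^2 <= 4*k*(M*lam0)^2) by (apply Rmult_le_compat_l; lra). lra.
Qed.
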